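(* Let $\hat p\in{}^*\mathbb N\setminus\mathbb N$ be a nonstandard prime and suppose the field $\overline{\mathbb Q}\cap\mathbb R$ of real algebraic numbers embeds (as a field) into $\mathbb F_{\hat p}$. If $\mathbb F_{\hat p}$ contains a square root of $-1$, then there is a subfield of $\mathbb F_{\hat p}$ which is almost internal, is a $\sigma$-set, is algebraically closed, and has cardinality at least $\mathfrak c$. If $\mathbb F_{\hat p}$ does not contain a square root of $-1$, then there is a subfield of $\mathbb F_{\hat p}$ which is almost internal, is a $\sigma$-set and is real closed; but in this case no real-closed subfield of $\mathbb F_{\hat p}$ which is a $\sigma$-set (whether or not it is almost internal) is $\aleph_1$-saturated. In both cases there are at least $2^{\mathfrak c}$ options to embed $\mathbb R$ in such an almost internal field.
   Context: Let $\mathcal F$ be a countably incomplete ultrafilter on a set $I$ and ${}^*\mathbb N=\mathbb N^I/\mathcal F$, with $\mathbb N\subseteq{}^*\mathbb N$ via constant sequences. With the superstructure $V(X)=\bigcup_n V_n(X)$ ($V_0(X)=X$, $V_{n+1}(X)=V_n(X)\cup\mathcal P(V_n(X))$) and the elementary embedding $*:V(\mathbb N)\to V({}^*\mathbb N)$ induced by the ultrapower, an element of $V({}^*\mathbb N)$ is internal if it lies in ${}^*A$ for some $A\in V(\mathbb N)$. For a nonstandard prime $\hat p\in{}^*P\setminus\mathbb N$ ($P$ the set of primes), $\mathbb F_{\hat p}=\{\hat n\in{}^*\mathbb N:\hat n<\hat p\}$ with operations modulo $\hat p$. A $\sigma$-set is a subset of ${}^*\mathbb N$ that is a union of countably many internal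 sets. A cut is a downward-closed subset of ${}^*\mathbb N$. A set is almost internal if it equals $f^{-1}[C]$ for some internal function $f$ with values in ${}^*\mathbb N$ and some cut $C$. $\mathfrak c=2^{\aleph_0}$. *)

(* Defs.v *)
From HB Require Import structures.
From mathcomp Require Import all_boot all_order all_algebra.
From mathcomp Require Import generic_quotient realalg.
From mathcomp Require Import boolp classical_sets functions cardinality filter.
From mathcomp Require Import reals.

Set Implicit Arguments.
Unset Strict Implicit.
Unset Printing Implicit Defensive.

Import GRing.Theory.
Local Open Scope classical_set_scope.

Definition countably_incomplete (I : Type) (F : set_system I) : Prop :=
  exists A : nat -> set I, (forall n, F (A n)) /\ ~ F (\bigcap_n A n).

Section HyperNaturals.
Variables (I : Type) (F : set_system I) (FU : UltraFilter F).

Let FF : Filter F := @filter_filter _ _ (@ultra_proper _ _ FU).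
Local Existing Instance FF.

Definition ultra_eq (a b : I -> nat) : bool := `[< F [set i | a i = b i] >].

Lemma ultra_eq_refl : reflexive ultra_eq.
Proof. by move=> a; apply/asboolP; apply: filterS filterT. Qed.

Lemma ultra_eq_sym : symmetric ultra_eq.
Proof. by move=> a b; apply/asboolP/asboolP; apply: filterS => i /=. Qed.

Lemma ultra_eq_trans : transitive ultra_eq.
Proof.
move=> b a c /asboolP ab /asboolP bc; apply/asboolP.
by apply: filterS2 ab bc => i /= -> ->.
Qed.

Definition ultra_equiv := EquivRel ultra_eq ultra_eq_refl ultra_eq_sym ultra_eq_trans.

Definition starN := {eq_quot ultra_equiv}%qT.
HB.instance Definition _ := Choice.on starN.
HB.instance Definition _ := EqQuotient.on starN.

Definition starN_of (a : I -> nat) : starN := (\pi_starN a)%qT.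

Definition starN_op (op : nat -> nat -> nat) (x y : starN) : starN :=
  starN_of (fun i => op (repr x i) (repr y i)).

Definition starN_rel (r : rel nat) (x y : starN) : bool :=
  `[< F [set i | r (repr x i) (repr y i)] >].

Definition standard : set starN := range (fun n : nat => starN_of (fun=> n)).

Definition cut (C : set starN) : Prop :=
  forall x y, C y -> starN_rel leq x y -> C x.

Lemma starN_ofP a b : starN_of a = starN_of b <-> F [set i | a i = b i].
Proof.
split; first by move=> /eqmodP /asboolP.
by move=> ab; apply/eqmodP/asboolP.
Qed.

Lemma starN_ofK x : starN_of (repr x) = x.
Proof. exact: reprK. Qed.

Lemma repr_starN_of a : F [set i | repr (starN_of a) i = a i].
Proof. by apply/starN_ofP; rewrite starN_ofK. Qed.

Lemma starN_opE op a b :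
  starN_op op (starN_of a) (starN_of b) = starN_of (fun i => op (a i) (b i)).
Proof.
apply/starN_ofP.
by apply: filterS2 (repr_starN_of a) (repr_starN_of b) => i /= -> ->.
Qed.

Lemma starN_relP (r : rel nat) a b :
  starN_rel r (starN_of a) (starN_of b) <-> F [set i | r (a i) (b i)].
Proof.
split=> [/asboolP|] h; last apply/asboolP.
  by apply: filterS3 (repr_starN_of a) (repr_starN_of b) h => i /= -> ->.
by apply: filterS3 (repr_starN_of a) (repr_starN_of b) h => i /= -> ->.
Qed.

End HyperNaturals.

(* [Vlevel X n] is $V_n(X)$, with the elements of X as atoms.  Since every set
   in $V_n(X)$ is a subset of $V_n(X)$, one has $V_{n+1}(X)=X\sqcup P(V_n(X))$,
   and the inclusion of $V_n(X)$ in $V_{n+1}(X)$ is [Vlift]. *)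
Fixpoint Vlevel (X : Type) (n : nat) : Type :=
  if n is m.+1 then (X + set (Vlevel X m))%type else X.

Section Superstructure.
Variable X : Type.

Definition Vset n (A : set (Vlevel X n)) : Vlevel X n.+1 := inr A.

Definition Vatom n : X -> Vlevel X n :=
  match n return X -> Vlevel X n with 0 => id | _.+1 => inl end.

Definition Vmem n (x : Vlevel X n) (y : Vlevel X n.+1) : Prop :=
  match y with inl _ => False | inr A => A x end.

Fixpoint Vlift n : Vlevel X n -> Vlevel X n.+1 :=
  match n return Vlevel X n -> Vlevel X n.+1 with
  | 0 => inl
  | m.+1 => fun x => match x with inl u => inl u | inr A => inr (@Vlift m @` A) end
  end.

Fixpoint Vlifts n k : Vlevel X n -> Vlevel X (k + n) :=
  match k return Vlevel X n -> Vlevel X (k + n) with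
  | 0 => id
  | j.+1 => fun x => Vlift (Vlifts j x)
  end.

(* Kuratowski pairs. *)
Definition Vpair n (x y : Vlevel X n) : Vlevel X n.+2 :=
  Vset [set Vset [set x]; Vset [set x; y]].

End Superstructure.

Section Star.
Variables (I : Type) (F : set_system I) (FU : UltraFilter F).

(* The element of $V_n({}^*N)$ represented by an I-sequence in $V_n(N)$, i.e. the
   Mostowski collapse of the ultrapower of $V_n(N)$: it is an atom if almost all
   terms are atoms, and otherwise the set of the [Vultra b] such that $b_i\in a_i$
   for almost all i. *)
Fixpoint Vultra n : (I -> Vlevel nat n) -> Vlevel (starN FU) n :=
  match n return (I -> Vlevel nat n) -> Vlevel (starN FU) n with
  | 0 => fun a => starN_of FU a
  | m.+1 => fun a =>
      if `[< F [set i | exists u : nat, a i = inl u] >]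
      then inl (starN_of FU (fun i => match a i with inl u => u | inr _ => 0 end))
      else inr [set Vultra b | b in [set b : I -> Vlevel nat m |
                                      F [set i | Vmem (b i) (a i)]]]
  end.

Definition star n (A : Vlevel nat n) : Vlevel (starN FU) n :=
  Vultra (fun=> A).

(* It is no restriction that A has a rank above that of x, as the levels of the
   superstructure are increasing. *)
Definition internal n (x : Vlevel (starN FU) n) : Prop :=
  exists k (A : Vlevel nat (k + n).+1), Vmem (Vlifts k x) (star A).

Definition internal_set (S : set (starN FU)) : Prop :=
  internal (Vset (S : set (Vlevel (starN FU) 0))).

Definition sigma_set (S : set (starN FU)) : Prop :=
  exists A : nat -> set (starN FU),
    (forall n, internal_set (A n)) /\ S = \bigcup_n A n.

(* f is the graph of a function, defined on a subset of $V_n({}^*N)$ and with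
   values in ${}^*N$. *)
Definition starN_function n (f : set (Vlevel (starN FU) n.+2)) : Prop :=
  (forall z, f z -> exists x y, z = Vpair x (Vatom n y)) /\
  (forall x y y', f (Vpair x (Vatom n y)) -> f (Vpair x (Vatom n y')) -> y = y').

Definition almost_internal (S : set (starN FU)) : Prop :=
  exists n (f : set (Vlevel (starN FU) n.+2)) (C : set (starN FU)),
    [/\ starN_function f, internal (Vset f), cut C &
        @Vatom (starN FU) n @` S =
          [set x | exists2 y, C y & f (Vpair x (Vatom n y))]].

Definition primes_set : Vlevel nat 1 :=
  Vset ([set n : nat | prime n] : set (Vlevel nat 0)).

Definition star_prime (p : starN FU) : Prop :=
  Vmem (p : Vlevel (starN FU) 0) (star primes_set).

End Star.

Record Fhat (I : Type) (F : set_system I) (FU : UltraFilter F) (p : starN FU)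
    (pP : star_prime p) :=
  MkFhat { Fhat_val :> starN FU; _ : starN_rel ltn Fhat_val p }.

Section PrimeField.
Variables (I : Type) (F : set_system I) (FU : UltraFilter F).
Variables (p : starN FU) (pP : star_prime p).

Let FF : Filter F := @filter_filter _ _ (@ultra_proper _ _ FU).
Local Existing Instance FF.


Lemma star_prime_repr : F [set i | prime (repr p i)].
Proof.
move: pP; rewrite /star_prime /star /=.
case: asboolP => [h|_] //= [b hb] bp.
have := repr_starN_of FU b; rewrite bp => rb.
by apply: filterS2 rb hb => i /= ->.
Qed.

Local Notation Fhat := (Fhat pP).

HB.instance Definition _ := [isSub of Fhat for @Fhat_val _ _ _ _ pP].
HB.instance Definition _ := [Choice of Fhat by <:].

Lemma Fhat_val_inj : injective (@Fhat_val _ _ _ _ pP).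
Proof. exact: val_inj. Qed.

Lemma modp_lt (x : starN FU) : starN_rel ltn (starN_op modn x p) p.
Proof.
rewrite -[x in starN_op _ x]starN_ofK -[p in X in _ X]starN_ofK starN_opE.
apply/starN_relP; apply: filterS star_prime_repr => i /= /prime_gt0.
exact: ltn_pmod.
Qed.

Definition modp (x : starN FU) : Fhat := MkFhat pP (modp_lt x).

Definition Fhat_of (a : I -> nat) : Fhat := modp (starN_of FU a).

Definition Fhat_zero : Fhat := Fhat_of (fun=> 0).
Definition Fhat_one : Fhat := Fhat_of (fun=> 1).
Definition Fhat_add (x y : Fhat) : Fhat := modp (starN_op addn x y).
Definition Fhat_mul (x y : Fhat) : Fhat := modp (starN_op muln x y).
Definition Fhat_opp (x : Fhat) : Fhat := modp (starN_op subn p x).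
Definition Fhat_inv (x : Fhat) : Fhat :=
  xget Fhat_zero [set y | Fhat_mul x y = Fhat_one].

Lemma Fhat_val_of a : Fhat_val (Fhat_of a) = starN_of FU (fun i => a i %% repr p i).
Proof. by rewrite /Fhat_of /modp /= -[p in LHS]starN_ofK starN_opE. Qed.

Lemma Fhat_ofP a b :
  Fhat_of a = Fhat_of b <-> F [set i | a i = b i %[mod repr p i]].
Proof.
split=> [/(congr1 (@Fhat_val _ _ _ _ pP))|h].
  by rewrite !Fhat_val_of => /starN_ofP.
by apply: Fhat_val_inj; rewrite !Fhat_val_of; apply/starN_ofP.
Qed.

Lemma Fhat_eq a b : (forall i, a i = b i %[mod repr p i]) -> Fhat_of a = Fhat_of b.
Proof. by move=> h; apply/Fhat_ofP; apply: filterS filterT => i _; exact: h. Qed.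

Lemma Fhat_ofK (x : Fhat) : Fhat_of (repr (Fhat_val x)) = x.
Proof.
apply: Fhat_val_inj; rewrite Fhat_val_of; case: x => x /= xp.
rewrite -[RHS]starN_ofK; apply/starN_ofP; move/asboolP: xp; apply: filterS => i /=.
exact: modn_small.
Qed.

Lemma Fhat_addE a b : Fhat_add (Fhat_of a) (Fhat_of b) = Fhat_of (fun i => a i + b i).
Proof.
rewrite /Fhat_add !Fhat_val_of starN_opE; apply: Fhat_eq => i.
by rewrite modnDm.
Qed.

Lemma Fhat_mulE a b : Fhat_mul (Fhat_of a) (Fhat_of b) = Fhat_of (fun i => a i * b i).
Proof.
rewrite /Fhat_mul !Fhat_val_of starN_opE; apply: Fhat_eq => i.
by rewrite modnMm.
Qed.

Lemma Fhat_oppE a :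
  Fhat_opp (Fhat_of a) = Fhat_of (fun i => repr p i - a i %% repr p i).
Proof.
have opE b : starN_op subn p (starN_of FU b) = starN_of FU (fun i => repr p i - b i).
  by rewrite -{1}[p]starN_ofK starN_opE.
by rewrite /Fhat_opp Fhat_val_of opE.
Qed.

Lemma Fhat_addA : associative Fhat_add.
Proof.
move=> x y z; rewrite -[x]Fhat_ofK -[y]Fhat_ofK -[z]Fhat_ofK !Fhat_addE.
by apply: Fhat_eq => i; rewrite addnA.
Qed.

Lemma Fhat_addC : commutative Fhat_add.
Proof.
move=> x y; rewrite -[x]Fhat_ofK -[y]Fhat_ofK !Fhat_addE.
by apply: Fhat_eq => i; rewrite addnC.
Qed.

Lemma Fhat_add0 : left_id Fhat_zero Fhat_add.
Proof. by move=> x; rewrite -[x]Fhat_ofK Fhat_addE; exact: Fhat_eq. Qed.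

Lemma Fhat_addN : left_inverse Fhat_zero Fhat_opp Fhat_add.
Proof.
move=> x; rewrite -[x]Fhat_ofK Fhat_oppE Fhat_addE; apply/Fhat_ofP.
apply: filterS star_prime_repr => i /= /prime_gt0 p0.
by rewrite -modnDmr subnK ?modnn ?mod0n // ltnW ?ltn_pmod.
Qed.

HB.instance Definition _ :=
  GRing.isZmodule.Build Fhat Fhat_addA Fhat_addC Fhat_add0 Fhat_addN.

Lemma Fhat_mulA : associative Fhat_mul.
Proof.
move=> x y z; rewrite -[x]Fhat_ofK -[y]Fhat_ofK -[z]Fhat_ofK !Fhat_mulE.
by apply: Fhat_eq => i; rewrite mulnA.
Qed.

Lemma Fhat_mulC : commutative Fhat_mul.
Proof.
move=> x y; rewrite -[x]Fhat_ofK -[y]Fhat_ofK !Fhat_mulE.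
by apply: Fhat_eq => i; rewrite mulnC.
Qed.

Lemma Fhat_mul1 : left_id Fhat_one Fhat_mul.
Proof.
by move=> x; rewrite -[x]Fhat_ofK Fhat_mulE; apply: Fhat_eq => i; rewrite mul1n.
Qed.

Lemma Fhat_mulDl : left_distributive Fhat_mul Fhat_add.
Proof.
move=> x y z; rewrite -[x]Fhat_ofK -[y]Fhat_ofK -[z]Fhat_ofK.
rewrite !(Fhat_mulE, Fhat_addE).
by apply: Fhat_eq => i; rewrite mulnDl.
Qed.

Lemma Fhat_one_neq0 : Fhat_one != Fhat_zero.
Proof.
apply/eqP => /Fhat_ofP h; apply: (@filter_not_empty _ _ (@ultra_proper _ _ FU)).
apply: filterS2 star_prime_repr h => i /= /prime_gt1 p1.
by rewrite mod0n modn_small.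
Qed.

HB.instance Definition _ := GRing.Zmodule_isComNzRing.Build Fhat
  Fhat_mulA Fhat_mulC Fhat_mul1 Fhat_mulDl Fhat_one_neq0.

Lemma Fhat_mulV_ex (x : Fhat) : x <> Fhat_zero -> exists y, Fhat_mul x y = Fhat_one.
Proof.
rewrite -[x]Fhat_ofK => x0; set a := repr (Fhat_val x) in x0 *.
exists (Fhat_of (fun i => (egcdn (a i) (repr p i)).1)); rewrite Fhat_mulE.
have [h|h] := @in_ultra_setVsetC _ _ [set i | (repr p i %| a i)%N] FU.
  case: x0; apply/Fhat_ofP; apply: filterS h => i /= /eqP.
  by rewrite mod0n.
apply/Fhat_ofP; apply: filterS2 star_prime_repr h => i /= pi /negP npa.
have a0 : 0 < a i by case: (a i) npa => //; rewrite dvdn0.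
case: egcdnP => //= u v uv _.
have /eqP g1 : coprime (a i) (repr p i) by rewrite coprime_sym prime_coprime.
by rewrite mulnC uv g1 modnMDl.
Qed.

Lemma Fhat_mulVf (x : Fhat) : x != 0%R -> (Fhat_inv x * x)%R = 1%R.
Proof.
move=> /eqP x0; have [y xy] := Fhat_mulV_ex x0.
by rewrite mulrC /Fhat_inv; case: xgetP => [z _ //|/(_ y)].
Qed.

Lemma Fhat_inv0 : Fhat_inv 0%R = 0%R.
Proof.
rewrite /Fhat_inv; case: xgetP => // y _ /= y1.
have : (0 * y = 1 :> Fhat)%R by [].
by rewrite mul0r => /eqP; rewrite eq_sym oner_eq0.
Qed.

HB.instance Definition _ := GRing.ComNzRing_isField.Build Fhat Fhat_mulVf Fhat_inv0.

End PrimeField.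

Section Subfield.
Variables (E : fieldType) (K : divringClosed E).

Record subfield := MkSubfield { subfield_val : E; _ : subfield_val \in K }.

HB.instance Definition _ := [isSub for subfield_val].
HB.instance Definition _ := [Choice of subfield by <:].
HB.instance Definition _ := [SubChoice_isSubUnitRing of subfield by <:].
HB.instance Definition _ := [SubNzRing_isSubComNzRing of subfield by <:].
HB.instance Definition _ := [SubComUnitRing_isSubIntegralDomain of subfield by <:].
HB.instance Definition _ := [SubIntegralDomain_isSubField of subfield by <:].

End Subfield.

Definition carrier (I : Type) (F : set_system I) (FU : UltraFilter F)
    (p : starN FU) (pP : star_prime p) (K : divringClosed (Fhat pP)) :
    set (starN FU) :=
  [set Fhat_val x | x in [set x : Fhat pP | x \in K]].

Definition algebraically_closed (K : fieldType) : Prop := GRing.closed_field_axiom K.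

Definition real_closed (K : fieldType) : Prop :=
  exists (R : rcfType) (f : {rmorphism R -> K}), bijective f.

Definition embeddings (A B : fieldType) : set (A -> B) :=
  range (fun f : {rmorphism A -> B} => f : A -> B).
Arguments embeddings : clear implicits.

Section Saturation.
Variable K : fieldType.

Fixpoint term_over (A : set K) (t : GRing.term K) : Prop :=
  match t with
  | GRing.Var _ | GRing.NatConst _ => True
  | GRing.Const c => A c
  | GRing.Add t1 t2 | GRing.Mul t1 t2 => term_over A t1 /\ term_over A t2
  | GRing.Opp t1 | GRing.NatMul t1 _ | GRing.Inv t1 | GRing.Exp t1 _ =>
      term_over A t1
  end.

Fixpoint formula_over (A : set K) (f : GRing.formula K) : Prop :=
  match f with
  | GRing.Bool _ => True
  | GRing.Equal t1 t2 => term_over A t1 /\ term_over A t2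
  | GRing.Unit t1 => term_over A t1
  | GRing.And f1 f2 | GRing.Or f1 f2 | GRing.Implies f1 f2 =>
      formula_over A f1 /\ formula_over A f2
  | GRing.Not f1 | GRing.Exists _ f1 | GRing.Forall _ f1 => formula_over A f1
  end.

(* Every finitely satisfiable set of formulas in the variable 'X_0, with
   parameters in a countable set, is realized.  Under the valuation [:: x] any
   other free variable is 0, so that it is in fact the constant 0.  The order of
   a real closed field, and the [GRing.Inv] and [GRing.Unit] of [GRing.formula],
   are definable in the language of rings, so that they do not affect the notion. *)
Definition aleph1_saturated : Prop :=
  forall (A : set K) (Phi : set (GRing.formula K)),
    countable A -> (forall f, Phi f -> formula_over A f) ->
    (forall Psi, finite_set Psi -> Psi `<=` Phi ->
       exists x, forall f, Psi f -> GRing.holds [:: x] f) ->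
    exists x, forall f, Phi f -> GRing.holds [:: x] f.

End Saturation.

(* Main.v *)
Require Import Defs.
From HB Require Import structures.
From mathcomp Require Import all_boot all_order all_algebra realalg.
From mathcomp Require Import boolp classical_sets functions cardinality filter reals.
From mathcomp Require Import polyorder polyrcf complex ring lra zify.

(** Representatives of the values of an embedding phi of the real algebraic
    numbers in Fhat give maps from the real algebraic numbers to the naturals
    which, by countable incompleteness, are compatible with + and * on an
    initial segment of infinite length of a fixed enumeration.  Inside this
    segment one finds an increasing sequence of internal levels, each closed
    under the field operations and under taking roots of polynomials of standard
    degree up to passing to the next level; their union is a real closed subfield
    of the ultrapower of the real algebraic numbers, and its reduction is the
    required field (to which a square root of -1 is adjoined if there is one).
    The rank of an element is an internal function, whence almost internality.

    This field has every real number t as a standard part.  A subfield on which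
    the standard part is injective, and which is maximal as such, is mapped onto
    the reals by Hensel's lemma, so that it is the image of an embedding; the
    lifts of continuum many algebraically independent reals (here Liouville
    numbers with almost disjoint supports) can be prescribed up to an
    infinitesimal, which gives 2^c embeddings.

    If -1 is not a square, then the order of a real closed subfield is the
    restriction of the internal relation "y - x is a square".  So an internal
    subset, being hyperfinite, has a maximum, a sigma-subfield has a countable
    cofinal subset, and it is not saturated. *)

Set Implicit Arguments.
Unset Strict Implicit.
Unset Printing Implicit Defensive.

Import Order.TTheory GRing.Theory Num.Theory.
Local Open Scope classical_set_scope.
Local Open Scope card_scope.
Local Open Scope ring_scope.

(** * Integer polynomial expressions and their partial derivatives *)

Section PolynomialExpressions.
Variable X : eqType.

(** Integer polynomials as syntax trees: one expression can be evaluated in every ring, and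
    estimates on its values go by structural induction. *)
Inductive expr :=
  | EVar of X | ECst of int | EAdd of expr & expr | EMul of expr & expr.

Fixpoint ev (A : pzRingType) (y : X -> A) (e : expr) : A :=
  match e with
  | EVar x => y x
  | ECst c => c%:~R
  | EAdd e1 e2 => ev y e1 + ev y e2
  | EMul e1 e2 => ev y e1 * ev y e2
  end.

Fixpoint evars (e : expr) : seq X :=
  match e with
  | EVar x => [:: x]
  | ECst _ => [::]
  | EAdd e1 e2 | EMul e1 e2 => evars e1 ++ evars e2
  end.

Fixpoint ederiv (x : X) (e : expr) : expr :=
  match e with
  | EVar z => ECst (x == z)%:Z
  | ECst _ => ECst 0
  | EAdd e1 e2 => EAdd (ederiv x e1) (ederiv x e2)
  | EMul e1 e2 => EAdd (EMul (ederiv x e1) e2) (EMul e1 (ederiv x e2))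
  end.

Definition char0 (A : pzRingType) := forall n : nat, n.+1%:R != 0 :> A.

(* The polynomial e is zero; it suffices to test it on domains of
   characteristic 0, a class of rings that is closed under polynomial rings. *)
Definition ezero (e : expr) : Prop :=
  forall (A : idomainType) (y : X -> A), char0 A -> ev y e = 0.

(** All partial derivatives of order k are the zero polynomial, which in characteristic 0 means
    total degree below k. It is the measure of the induction in [liou_independent]. *)
Fixpoint ederiv_zero (k : nat) (e : expr) : Prop :=
  if k is j.+1 then forall x, ederiv_zero j (ederiv x e) else ezero e.

Lemma ev_ext (A : pzRingType) (y z : X -> A) e :
  {in evars e, y =1 z} -> ev y e = ev z e.
Proof.
elim: e => [x|c|e1 IH1 e2 IH2|e1 IH1 e2 IH2] //= yz; first by rewrite yz ?inE.
  by rewrite IH1 ?IH2 // => x xe; apply: yz; rewrite mem_cat xe ?orbT.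
by rewrite IH1 ?IH2 // => x xe; apply: yz; rewrite mem_cat xe ?orbT.
Qed.

Lemma ev_rmorph (A B : pzRingType) (f : {rmorphism A -> B}) (y : X -> A) e :
  f (ev y e) = ev (f \o y) e.
Proof.
elim: e => [x|c|e1 IH1 e2 IH2|e1 IH1 e2 IH2] //=.
- by rewrite rmorph_int.
- by rewrite rmorphD IH1 IH2.
- by rewrite rmorphM IH1 IH2.
Qed.

Lemma ev_horner (A : comNzRingType) (z : X -> {poly A}) w e :
  (ev z e).[w] = ev (fun u => (z u).[w]) e.
Proof. exact: (ev_rmorph (horner_eval w)). Qed.

Lemma ev_deriv (A : comNzRingType) (z : X -> {poly A}) x e :
  (forall u, (z u)^`() = (x == u)%:R) -> (ev z e)^`() = ev z (ederiv x e).
Proof.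
move=> zx; elim: e => [u|c|f IH1 g IH2|f IH1 g IH2] /=.
- by rewrite zx; case: eqP.
- by rewrite -(rmorph_int (@polyC A)) derivC mulr0z.
- by rewrite derivD IH1 IH2.
- by rewrite derivM IH1 IH2.
Qed.

Lemma char0_poly (A : idomainType) : char0 A -> char0 {poly A}.
Proof. by move=> A0 n; rewrite -(rmorph_nat (@polyC A)) polyC_eq0 A0. Qed.

(** Perturb the variable x to [y x + 'X] over [{poly A}], again a domain of characteristic 0: the
    vanishing value has derivative 0, and at 0 this derivative is the partial derivative at y. *)
Lemma ezero_ederiv e : ezero e -> forall x, ezero (ederiv x e).
Proof.
move=> e0 x A y A0.
pose z u : {poly A} := (y u)%:P + (x == u)%:R *: 'X.
have zx u : (z u)^`() = (x == u)%:R.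
  by rewrite derivD derivC derivZ derivX add0r scaler_nat.
have := ev_deriv e zx; rewrite (e0 _ z (char0_poly A0)) deriv0.
move=> /(congr1 (fun q => q.[0])); rewrite horner0 ev_horner => ->.
by apply: ev_ext => u _; rewrite /z !hornerE ?mulr0 ?addr0.
Qed.

Lemma ederiv_zeroS k e : ederiv_zero k e -> ederiv_zero k.+1 e.
Proof.
elim: k e => [|k IH] e; first exact: ezero_ederiv.
by move=> ez x; apply: IH; exact: ez.
Qed.

Lemma ederiv_zero_le k l e : (k <= l)%N -> ederiv_zero k e -> ederiv_zero l e.
Proof. by move=> /subnK <-; elim: (l - k)%N => //= j IH /IH /ederiv_zeroS. Qed.

Lemma ederiv_zeroD k e1 e2 :
  ederiv_zero k e1 -> ederiv_zero k e2 -> ederiv_zero k (EAdd e1 e2).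
Proof.
elim: k e1 e2 => [|k IH] e1 e2 /= h1 h2; last by move=> x; apply: IH.
by move=> A y A0; rewrite /= h1 ?h2 ?addr0.
Qed.

(** Double induction through the Leibniz rule; when one count is 0, that factor and hence the
    product is the zero polynomial. *)
Lemma ederiv_zeroM j k e1 e2 :
  ederiv_zero j e1 -> ederiv_zero k e2 -> ederiv_zero (j + k) (EMul e1 e2).
Proof.
elim: j k e1 e2 => [|j IHj] k e1 e2 h1 h2.
  apply: (@ederiv_zero_le 0%N) => // A y A0.
  by rewrite /= (h1 A y A0) mul0r.
elim: k e1 e2 h1 h2 => [|k IHk] e1 e2 h1 h2.
  apply: (@ederiv_zero_le 0%N) => // A y A0.
  by rewrite /= (h2 A y A0) mulr0.
rewrite addSn => x; apply: ederiv_zeroD.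
  by apply: IHj => //; exact: h1.
by have := IHk e1 (ederiv x e2) h1 (h2 x); rewrite addSnnS.
Qed.

Lemma ederiv_zero_ex e : exists k, ederiv_zero k e.
Proof.
elim: e => [x|c|e1 [j h1] e2 [k h2]|e1 [j h1] e2 [k h2]].
- by exists 2%N => z w A y A0 /=.
- by exists 1%N => z A y A0 /=.
- exists (maxn j k); apply: ederiv_zeroD.
    by apply: ederiv_zero_le h1; rewrite leq_maxl.
  by apply: ederiv_zero_le h2; rewrite leq_maxr.
- by exists (j + k)%N; exact: ederiv_zeroM.
Qed.

(** With ['X] in place of the variable x the value becomes a one-variable polynomial of derivative
    0, hence constant in characteristic 0; both sides are values of it. *)
Lemma ev_update_const (A : idomainType) (y : X -> A) x v e :
  char0 A -> (forall z, ezero (ederiv z e)) ->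
  ev [eta y with x |-> v] e = ev y e.
Proof.
move=> A0 e0.
pose z u : {poly A} := if x == u then 'X else (y u)%:P.
have zx u : (z u)^`() = (x == u)%:R.
  by rewrite /z; case: eqP => _; rewrite ?derivX ?derivC.
have zc : ev z e = ((ev z e)`_0)%:P.
  apply/polyP => -[|n]; rewrite coefC //=.
  have := congr1 (fun q : {poly A} => q`_n) (ev_deriv e zx).
  rewrite (e0 x _ z (char0_poly A0)) coef0 coef_deriv -mulr_natr => /eqP.
  by rewrite mulf_eq0 (negPf (A0 n)) orbF => /eqP.
have at_v w : (ev z e).[w] = ev [eta y with x |-> w] e.
  rewrite ev_horner; apply: ev_ext => u _ /=.
  by rewrite /z [u == x]eq_sym; case: ifP => _; rewrite !hornerE.
have atc w : ev [eta y with x |-> w] e = (ev z e)`_0.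
  by rewrite -at_v {1}zc hornerC.
rewrite atc -(atc (y x)).
by apply: ev_ext => u _ /=; case: eqP => [->|].
Qed.

(** The finitely many variables of e are set to 0 one after the other; the value at 0 comes from the
    integers. *)
Lemma ev_const (A : idomainType) (y : X -> A) e :
  char0 A -> (forall z, ezero (ederiv z e)) ->
  ev y e = (ev (fun=> 0 : int) e)%:~R.
Proof.
move=> A0 e0.
have main (s : seq X) : ev (fun u => if u \in s then 0 else y u) e = ev y e.
  elim: s => [|x s IH]; first exact: ev_ext.
  rewrite -IH -[RHS](ev_update_const _ x 0 A0 e0); apply: ev_ext => u _ /=.
  by rewrite inE; case: (u == x).
rewrite -(main (evars e)) (ev_rmorph (intmul (1 : A)) (fun=> 0 : int)).
by apply: ev_ext => u /= ->.
Qed.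

End PolynomialExpressions.

Lemma char0_numDomain (A : numDomainType) : char0 A.
Proof. by move=> n; rewrite pnatr_eq0. Qed.

(** * Almost disjoint sets of naturals *)

Section AlmostDisjoint.
Implicit Types x z : set nat.

(** The binary number formed by a leading 1 followed by the first m bits of x. The leading 1 makes
    the length recoverable, so that equal codes come from equal initial segments. *)
Fixpoint branch_code x (m : nat) : nat :=
  if m is k.+1 then ((branch_code x k).*2 + `[<x k>])%N else 1%N.

Lemma branch_code_gt x m : (m < branch_code x m)%N.
Proof. by elim: m => //= m IH; lia. Qed.

Lemma branch_code_eq x z m m' : branch_code x m = branch_code z m' ->
  m = m' /\ forall k, (k < m)%N -> x k <-> z k.
Proof.
elim: m m' => [|m IH] [|m'] //=.
- by have := branch_code_gt z m'; lia.
- by have := branch_code_gt x m; lia.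
move=> E; have [Ec Eb] : branch_code x m = branch_code z m' /\ `[<x m>] = `[<z m'>].
  by split; move: E; case: (asbool (x m)); case: (asbool (z m')) => /=; lia.
have [mm' h] := IH _ Ec; subst m'; split => // k.
rewrite ltnS leq_eqVlt => /predU1P[->|/h //].
by split=> /asboolP xk; apply/asboolP; [rewrite -Eb|rewrite Eb].
Qed.

(** The codes of all initial segments of x; two distinct sets share only finitely many. *)
Definition branch x (n : nat) : bool := `[< exists m, branch_code x m = n >].

(** Past some m, the set x has differed from every other member of s, so the code of a longer
    initial segment of x lies on the branch of no other member of s. *)
Lemma branch_separated (s : seq (set nat)) x n0 :
  exists2 n, (n0 <= n)%N & forall z, z \in s -> branch z n = (x == z).
Proof.
have [m mP] : exists m, forall z, z \in s -> x != z ->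
    exists2 k, (k < m)%N & ~ (x k <-> z k).
  elim: s => [|z s [m IH]]; first by exists 0%N.
  have [xz|xz] := eqVneq x z.
    exists m => w; rewrite inE => /predU1P[->|]; last exact: IH.
    by rewrite xz eqxx.
  have [k kP] : exists k, ~ (x k <-> z k).
    apply/existsNP => h; move/eqP: xz; apply; apply/seteqP.
    by split=> k; have := h k; tauto.
  exists (maxn m k.+1) => w; rewrite inE => /predU1P[->|ws xw].
    by exists k => //; rewrite leq_max ltnSn orbT.
  by have [j jm jP] := IH _ ws xw; exists j => //; rewrite leq_max jm.
pose l := maxn m n0; exists (branch_code x l).
  by have := branch_code_gt x l; rewrite /l; lia.
move=> z zs; apply/asboolP/eqP => [[l' E]|->]; last by exists l.
apply/eqP; apply: contrapT => /negP xz.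
have [k km kP] := mP z zs xz; have [_] := branch_code_eq (esym E).
by move=> /(_ k); rewrite (leq_trans km) ?leq_maxl // => /(_ isT).
Qed.

End AlmostDisjoint.

(** * Algebraically independent Liouville numbers *)

Section IndependentReals.
Variable R : realType.
Local Notation X := (set nat).
Implicit Types (e : expr X) (y z : X -> R).

(** The factorial exponent makes [liouM n.+1] the power n+2 of [liouM n], so the tail after digit n
    is smaller than any fixed power of the inverse of [liouM n] once n is large. *)
Definition liouM (n : nat) : nat := (2 ^ (n.+1)`!)%N.
Definition lioueps (n : nat) : R := (liouM n)%:R^-1.

Lemma liouM_gt0 n : (0 < liouM n)%N. Proof. by rewrite expn_gt0. Qed.

Lemma liouMS n : liouM n.+1 = (liouM n ^ n.+2)%N.
Proof. by rewrite /liouM factS -expnM mulnC. Qed.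

Lemma liouM_gt n : (n.+1 < liouM n)%N.
Proof.
rewrite /liouM; apply: (leq_trans (ltn_expl n.+1 (ltnSn 1))).
by rewrite leq_exp2l // fact_geq.
Qed.

Lemma lioueps_gt0 n : 0 < lioueps n.
Proof. by rewrite invr_gt0 ltr0n liouM_gt0. Qed.

Lemma lioueps_half n : 2 * lioueps n.+1 <= lioueps n.
Proof.
rewrite /lioueps liouMS natrX.
have M2 : 2 <= (liouM n)%:R :> R.
  by rewrite ler_nat (leq_trans _ (liouM_gt n)).
set M := (liouM n)%:R in M2 *; have M0 : 0 < M by apply: lt_le_trans M2.
rewrite ler_pdivrMr ?exprn_gt0 // exprS mulKf ?gt_eqF //.
rewrite exprS (le_trans M2) // ler_peMr ?exprn_ege1 ?ltW //.
by apply: lt_le_trans M2; rewrite ltr1n.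
Qed.

Definition liou_trunc (n : nat) (x : X) : R :=
  \sum_(k < n) (branch x k)%:R * lioueps k.

Lemma liou_truncS n x :
  liou_trunc n.+1 x = liou_trunc n x + (branch x n)%:R * lioueps n.
Proof. exact: big_ord_recr. Qed.

(** Truncations increase with n, while the bounds [liou_trunc n x + 2 * lioueps n] decrease because
    [lioueps] at least halves at each step; so every bound dominates every truncation. *)
Lemma liou_trunc_le x m n : liou_trunc m x <= liou_trunc n x + 2 * lioueps n.
Proof.
have incr k : liou_trunc k x <= liou_trunc k.+1 x.
  by rewrite liou_truncS lerDl mulr_ge0 ?ler0n // ltW ?lioueps_gt0.
have decr k : liou_trunc k.+1 x + 2 * lioueps k.+1 <= liou_trunc k x + 2 * lioueps k.
  rewrite liou_truncS; have := lioueps_half k; have := lioueps_gt0 k.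
  by case: (branch x k) => /=; lra.
have [mn|/ltnW nm] := leqP m n.
  apply: (@le_trans _ _ (liou_trunc n x)); last first.
    by rewrite lerDl mulr_ge0 // ltW ?lioueps_gt0.
  by move: mn => /subnK <-; elim: (n - m)%N => // j IH; rewrite addSn (le_trans IH).
apply: (@le_trans _ _ (liou_trunc m x + 2 * lioueps m)).
  by rewrite lerDl mulr_ge0 // ltW ?lioueps_gt0.
move: nm => /subnK <-; elim: (m - n)%N => // j IH.
by rewrite addSn (le_trans (decr _)).
Qed.

Lemma liou_trunc_ge0 n x : 0 <= liou_trunc n x.
Proof. by apply: sumr_ge0 => k _; rewrite mulr_ge0 ?ler0n // ltW ?lioueps_gt0. Qed.

Definition liou (x : X) : R := sup (range (liou_trunc ^~ x)).

Lemma liou_has_sup x : has_sup (range (liou_trunc ^~ x)).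
Proof.
split; first by exists (liou_trunc 0 x), 0%N.
by exists (liou_trunc 0 x + 2 * lioueps 0) => _ [n _ <-]; exact: liou_trunc_le.
Qed.

Lemma liou_approx n x : `|liou_trunc n x - liou x| <= 2 * lioueps n.
Proof.
rewrite ler_norml; apply/andP; split.
  rewrite lerBrDr addrC lerBlDr; apply: ge_sup; first by case: (liou_has_sup x).
  by move=> _ [m _ <-]; exact: liou_trunc_le.
rewrite lerBlDr (@le_trans _ _ (liou x)) //; last first.
  by rewrite lerDr mulr_ge0 // ltW ?lioueps_gt0.
by apply: ub_le_sup; [case: (liou_has_sup x) | exists n].
Qed.

Definition bounded3 y := forall x, `|y x| <= 3.

Lemma ev_bounded e : exists2 C, 0 <= C & forall y, bounded3 y -> `|ev y e| <= C.
Proof.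
elim: e => [x|c|e1 [C1 C10 h1] e2 [C2 C20 h2]|e1 [C1 C10 h1] e2 [C2 C20 h2]] /=.
- by exists 3.
- by exists `|c%:~R|.
- exists (C1 + C2) => [|y yb]; first exact: addr_ge0.
  by rewrite (le_trans (ler_normD _ _)) // lerD ?h1 ?h2.
- exists (C1 * C2) => [|y yb]; first exact: mulr_ge0.
  by rewrite normrM ler_pM ?h1 ?h2.
Qed.

Lemma ev_lipschitz e : exists2 C, 0 <= C & forall y z d,
  bounded3 y -> bounded3 z -> (forall x, `|y x - z x| <= d) ->
  `|ev y e - ev z e| <= C * d.
Proof.
elim: e => [x|c|e1 [C1 C10 h1] e2 [C2 C20 h2]|e1 [C1 C10 h1] e2 [C2 C20 h2]] /=.
- by exists 1 => // y z d _ _ h; rewrite mul1r.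
- exists 0 => // y z d _ _ h; by rewrite subrr normr0 mul0r.
- exists (C1 + C2) => [|y z d yb zb h]; first exact: addr_ge0.
  rewrite opprD addrACA mulrDl (le_trans (ler_normD _ _)) //.
  by rewrite lerD ?h1 ?h2.
- have [B1 B10 b1] := ev_bounded e1; have [B2 B20 b2] := ev_bounded e2.
  exists (C1 * B2 + B1 * C2) => [|y z d yb zb h]; first by rewrite addr_ge0 ?mulr_ge0.
  have -> : ev y e1 * ev y e2 - ev z e1 * ev z e2 =
    (ev y e1 - ev z e1) * ev y e2 + ev z e1 * (ev y e2 - ev z e2) by ring.
  rewrite (le_trans (ler_normD _ _)) // !normrM.
  rewrite mulrDl -(mulrA B1) [C1 * _ * _]mulrAC.
  by rewrite lerD // ler_pM ?h1 ?h2 ?b1 ?b2.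
Qed.

(** First-order Taylor expansion in the variable x with a remainder uniform in y. Only the variables
    of e are constrained, since at a given digit other sets may have a nonzero bit too. *)
Lemma ev_taylor e x : exists2 C, 0 <= C & forall y z d,
  bounded3 y -> bounded3 z -> 0 <= d <= 1 ->
  (forall u, u \in evars e -> z u = y u + (x == u)%:R * d) ->
  `|ev z e - ev y e - d * ev y (ederiv x e)| <= C * d ^+ 2.
Proof.
elim: e => [u|c|e1 [C1 C10 h1] e2 [C2 C20 h2]|e1 [C1 C10 h1] e2 [C2 C20 h2]] /=.
- exists 0 => // y z d _ _ _ ->; last by rewrite inE.
  rewrite -pmulrn mul0r (_ : _ - _ - _ = 0) ?normr0 //; ring.
- exists 0 => // y z d _ _ _ _.
  by rewrite subrr mulr0 subrr normr0 mul0r.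
- exists (C1 + C2) => [|y z d yb zb d01 h]; first exact: addr_ge0.
  have -> : ev z e1 + ev z e2 - (ev y e1 + ev y e2) -
      d * (ev y (ederiv x e1) + ev y (ederiv x e2)) =
    (ev z e1 - ev y e1 - d * ev y (ederiv x e1)) +
    (ev z e2 - ev y e2 - d * ev y (ederiv x e2)) by ring.
  rewrite mulrDl (le_trans (ler_normD _ _)) //.
  by rewrite lerD ?h1 ?h2 // => v ve; apply: h; rewrite mem_cat ve ?orbT.
- have [B1 B10 b1] := ev_bounded e1; have [B2 B20 b2] := ev_bounded e2.
  have [D1 D10 d1] := ev_bounded (ederiv x e1).
  have [D2 D20 d2] := ev_bounded (ederiv x e2).
  exists (C1 * B2 + B1 * C2 + D1 * (D2 + C2)) => [|y z d yb zb d01 h].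
    by rewrite !addr_ge0 ?mulr_ge0 ?addr_ge0.
  have r1 : `|ev z e1 - ev y e1 - d * ev y (ederiv x e1)| <= C1 * d ^+ 2.
    by apply: h1 => // v ve; apply: h; rewrite mem_cat ve.
  have r2 : `|ev z e2 - ev y e2 - d * ev y (ederiv x e2)| <= C2 * d ^+ 2.
    by apply: h2 => // v ve; apply: h; rewrite mem_cat ve orbT.
  have /andP[d0 d1'] := d01.
  have dd : d ^+ 2 <= d by rewrite expr2 ler_piMl.
  have q2 : `|ev z e2 - ev y e2| <= (D2 + C2) * d.
    rewrite -[ev z e2 - _](subrK (d * ev y (ederiv x e2))) addrC.
    rewrite (le_trans (ler_normD _ _)) // mulrDl lerD //.
      by rewrite normrM (ger0_norm d0) mulrC ler_wpM2r ?d2.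
    by rewrite (le_trans r2) // ler_wpM2l.
  have -> : ev z e1 * ev z e2 - ev y e1 * ev y e2 -
      d * (ev y (ederiv x e1) * ev y e2 + ev y e1 * ev y (ederiv x e2)) =
    (ev z e1 - ev y e1 - d * ev y (ederiv x e1)) * ev z e2 +
    ev y e1 * (ev z e2 - ev y e2 - d * ev y (ederiv x e2)) +
    d * (ev y (ederiv x e1) * (ev z e2 - ev y e2)) by ring.
  have -> : (C1 * B2 + B1 * C2 + D1 * (D2 + C2)) * d ^+ 2 =
     (C1 * d ^+ 2) * B2 + B1 * (C2 * d ^+ 2) + d * (D1 * ((D2 + C2) * d)) by ring.
  rewrite (le_trans (ler_normD _ _)) // lerD ?(le_trans (ler_normD _ _)) // ?lerD //.
  + by rewrite normrM ler_pM ?b2.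
  + by rewrite normrM ler_pM ?b1.
  + by rewrite !normrM (ger0_norm d0) ler_wpM2l // ler_pM ?d1.
Qed.

(** A truncation up to digit n is a fraction with denominator [liouM n]; the exponent d is a bound
    on the degree of e. *)
Lemma ev_denominator e : exists d, forall n,
  exists c : int, ev (liou_trunc n.+1) e * (liouM n)%:R ^+ d = c%:~R.
Proof.
elim: e => [x|c|e1 [j h1] e2 [k h2]|e1 [j h1] e2 [k h2]] /=.
- exists 1%N => n; rewrite expr1.
  have dvdM k m : (k <= m)%N -> (liouM k %| liouM m)%N.
    by move=> km; rewrite dvdn_exp2l // leq_fact.
  exists (\sum_(k < n.+1) (branch x k)%:Z * (liouM n %/ liouM k)%N%:Z).
  rewrite mulr_suml rmorph_sum /=; apply: eq_bigr => k _.
  rewrite rmorphM /= -!pmulrn -mulrA; congr (_ * _).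
  have -> : (liouM n)%:R = (liouM n %/ liouM k)%:R * (liouM k)%:R :> R.
    by rewrite -natrM divnK // dvdM // -ltnS.
  rewrite /lioueps mulrCA mulVf ?mulr1 //.
  by rewrite pnatr_eq0 -lt0n liouM_gt0.
- by exists 0%N => n; exists c; rewrite expr0 mulr1.
- exists (j + k)%N => n; have [c1 E1] := h1 n; have [c2 E2] := h2 n.
  exists (c1 * (liouM n)%:Z ^+ k + c2 * (liouM n)%:Z ^+ j).
  rewrite rmorphD !rmorphM !rmorphXn /= -E1 -E2 -!pmulrn exprD; ring.
- exists (j + k)%N => n; have [c1 E1] := h1 n; have [c2 E2] := h2 n.
  by exists (c1 * c2); rewrite rmorphM /= -E1 -E2 exprD; ring.
Qed.

Lemma lioueps_le n : lioueps n <= 1.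
Proof.
by rewrite invf_le1 ?ltr0n ?ler1n ?liouM_gt0.
Qed.

Lemma bounded3_trunc n : bounded3 (liou_trunc n).
Proof.
move=> x; rewrite ger0_norm ?liou_trunc_ge0 //.
have := liou_trunc_le x n 0; rewrite /liou_trunc big_ord0.
by have := lioueps_le 0; lra.
Qed.

Lemma bounded3_liou : bounded3 liou.
Proof.
move=> x; rewrite -normrN -[- _](addKr (liou_trunc 0 x)).
have := liou_approx 0 x; rewrite /liou_trunc big_ord0 oppr0 !add0r.
by move=> /le_trans; apply; have := lioueps_le 0; lra.
Qed.

Lemma lioueps_small (C : R) :
  exists n0, forall n, (n0 <= n)%N -> C * lioueps n < 1.
Proof.
exists (Num.bound C) => n n0n.
rewrite ltr_pdivrMr ?ltr0n ?liouM_gt0 // mul1r.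
have [C0|C0] := leP C 0; first by rewrite (le_lt_trans C0) ?ltr0n ?liouM_gt0.
apply: (lt_le_trans (archi_boundP (ltW C0))); rewrite ler_nat.
by rewrite (leq_trans n0n) // ltnW // ltnW // liouM_gt.
Qed.

Lemma lioueps_pow d n : (d <= n)%N ->
  lioueps n.+1 * (liouM n)%:R ^+ d <= lioueps n.
Proof.
move=> dn; have M1 : 1 <= (liouM n)%:R :> R by rewrite ler1n liouM_gt0.
have M0 : 0 < (liouM n)%:R :> R by apply: lt_le_trans M1.
rewrite /lioueps liouMS natrX ler_pdivrMl ?exprn_gt0 // ler_pdivlMr //.
by rewrite -exprSr ler_weXn2l // ltnS leqW.
Qed.

(** Liouville's argument: the value at the truncation is an integer divided by a fixed power of
    [liouM n], and it is too close to the value 0 at the limit to be a nonzero fraction of this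
    kind. *)
Lemma ev_trunc_eq0 e : ev liou e = 0 ->
  exists n0, forall n, (n0 <= n)%N -> ev (liou_trunc n) e = 0.
Proof.
move=> e0; have [C C0 lip] := ev_lipschitz e; have [d dP] := ev_denominator e.
have [n1 n1P] := lioueps_small (C * 2).
(* The shift by one matches the denominators, which come from digits up to n, with the error of the
   truncation [n.+1], which is of size [lioueps n.+1]. *)
exists (maxn n1 d).+1 => -[//|n]; rewrite ltnS geq_max => /andP[n1n dn].
have [c cE] := dP n.
have M1 : 1 <= (liouM n)%:R :> R by rewrite ler1n liouM_gt0.
have M0 : 0 < (liouM n)%:R :> R by rewrite (lt_le_trans _ M1).
have : `|ev (liou_trunc n.+1) e * (liouM n)%:R ^+ d| < 1.
  rewrite normrM [X in _ * X]ger0_norm ?exprn_ge0 ?ler0n //.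
  have := lip _ _ _ (bounded3_trunc n.+1) bounded3_liou (liou_approx n.+1).
  rewrite e0 subr0 => /(ler_wpM2r (exprn_ge0 d (ltW M0))) /le_lt_trans; apply.
  apply: le_lt_trans (n1P n n1n); rewrite mulrA -!mulrA; do 2 apply: ler_wpM2l => //.
  exact: lioueps_pow.
rewrite cE -intr_norm ltrz1 => c0.
have {c0} c0 : c = 0 by lia.
by move/eqP: cE; rewrite c0 mulf_eq0 expf_eq0 (gt_eqF M0) andbF orbF => /eqP.
Qed.

(** For suitable large n, passing from truncation n to n+1 changes, among the variables of e, only
    x. Both values of e are 0, so the Taylor formula makes the derivative at truncation n of order
    [lioueps n], and then also the derivative at the limit. *)
Lemma ev_ederiv_eq0 e x : ev liou e = 0 -> ev liou (ederiv x e) = 0.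
Proof.
move=> e0; apply/eqP; apply: contrapT => /negP; rewrite -normr_gt0.
set D := `|_| => D0.
have [C C0 tay] := ev_taylor e x; have [L L0 lip] := ev_lipschitz (ederiv x e).
have [n0 n0P] := ev_trunc_eq0 e0; have [n1 n1P] := lioueps_small ((C + L * 2) / D).
have [n] := branch_separated (evars e) x (maxn n0 n1).
rewrite geq_max => /andP[n0n n1n] nP.
have en0 := lioueps_gt0 n.
have : `|ev (liou_trunc n) (ederiv x e)| <= C * lioueps n.
  have := tay _ _ (lioueps n) (bounded3_trunc n) (bounded3_trunc n.+1).
  rewrite (ltW en0) lioueps_le n0P ?n0P ?leqW // subrr sub0r normrN normrM.
  rewrite (gtr0_norm en0) expr2 mulrCA ler_pM2l //; apply => // u ue.
  by rewrite liou_truncS nP.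
have := lip _ _ _ (bounded3_trunc n) bounded3_liou (liou_approx n).
have := n1P n n1n; rewrite mulrAC ltr_pdivrMr // mul1r.
have : D <= `|ev (liou_trunc n) (ederiv x e) - ev liou (ederiv x e)| +
            `|ev (liou_trunc n) (ederiv x e)|.
  by rewrite distrC -lerBlDr lerB_dist.
by lra.
Qed.

(** Induction on the order at which the derivatives of e vanish: all first derivatives are zero
    polynomials by induction, so e is a constant integer, and this integer is 0. *)
Theorem liou_independent e : ev liou e = 0 -> ezero e.
Proof.
have [k] := ederiv_zero_ex e; elim: k e => [|k IH] e //= ek e0.
have De0 x : ezero (ederiv x e) by apply: IH => //; exact: ev_ederiv_eq0.
move=> A y A0; rewrite (ev_const y A0 De0); move/eqP: e0.
by rewrite (ev_const _ (@char0_numDomain R) De0) intr_eq0 => /eqP ->.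
Qed.

Lemma liou_inj : injective liou.
Proof.
move=> x z xz; apply/eqP; apply: contrapT => /negP nxz.
have : ezero (EAdd (EVar x) (EMul (ECst _ (-1)) (EVar z))).
  by apply: liou_independent; rewrite /= xz mulN1r subrr.
move=> /(_ int (fun u => (u == x)%:R) (@char0_numDomain int)) /=.
by rewrite eqxx [z == x]eq_sym (negPf nxz) mulr0.
Qed.

End IndependentReals.

(** * Morphisms and subfields obtained from plain functions and sets *)

Definition rmorph_of (A B : nzRingType) (f : A -> B) (f1 : f 1 = 1)
    (fB : {morph f : x y / x - y}) (fM : {morph f : x y / x * y}) :
    {rmorphism A -> B} :=
  HB.pack f (GRing.isZmodMorphism.Build A B f fB)
    (GRing.isMonoidMorphism.Build A B f (f1, fM)).

Section DivringOf.
Variables (E : fieldType) (D : set E).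
Hypothesis D1 : D 1.
Hypothesis DB : forall u v, D u -> D v -> D (u - v).
Hypothesis DV : forall u v, D u -> D v -> D (u / v).

Definition asbool_pred : {pred E} := fun u => `[< D u >].

Lemma asbool_divring_closed : divring_closed asbool_pred.
Proof.
split=> [|u v|u v]; rewrite !unfold_in; first exact/asboolP.
  by move=> /asboolP Du /asboolP Dv; apply/asboolP; exact: DB.
by move=> /asboolP Du /asboolP Dv; apply/asboolP; exact: DV.
Qed.

Definition divring_of : divringClosed E :=
  HB.pack asbool_pred
    (GRing.isDivringClosed.Build E asbool_pred asbool_divring_closed).

Lemma mem_divring_of u : u \in divring_of <-> D u.
Proof.
by rewrite unfold_in /= /asbool_pred; split=> [/asboolP|h]; last exact/asboolP.
Qed.

End DivringOf.

(** * Rational approximation and standard parts *)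

Section Close.
Variable F : realFieldType.
Implicit Types u v q r e B d : F.

Lemma close_mul u v q r e B : `|u - q| <= e -> `|v - r| <= e -> e <= 1 ->
  `|q| <= B -> `|r| <= B -> `|u * v - q * r| <= e * (2 * B + 1).
Proof.
move=> uq vr e1 qB rB.
have -> : u * v - q * r = (u - q) * v + q * (v - r) by ring.
have vB : `|v| <= B + 1.
  by rewrite -[v](subrK r) (le_trans (ler_normD _ _)) // addrC lerD // (le_trans vr).
rewrite (le_trans (ler_normD _ _)) // !normrM.
have -> : e * (2 * B + 1) = e * (B + 1) + B * e by ring.
by rewrite lerD // ler_pM.
Qed.

Lemma close_inv u q e d : `|u - q| <= e -> 0 < d -> d <= `|q| -> 2 * e <= d ->
  `|u^-1 - q^-1| <= e * (2 / d ^+ 2).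
Proof.
move=> uq d0 dq ed; have q0 : q != 0 by rewrite -normr_gt0 (lt_le_trans d0).
have ud : d / 2 <= `|u|.
  have : `|q| <= `|u - q| + `|u| by rewrite distrC -lerBlDr lerB_dist.
  by move: uq dq ed; lra.
have u0 : u != 0 by rewrite -normr_gt0 (lt_le_trans _ ud) ?divr_gt0.
have -> : u^-1 - q^-1 = (q - u) / (u * q) by (field; rewrite u0 q0).
rewrite normrM normfV normrM distrC ler_pM ?invr_ge0 ?mulr_ge0 //.
have -> : 2 / d ^+ 2 = (d / 2 * d)^-1 by (field; rewrite gt_eqF).
have d20 : 0 < d / 2 by rewrite divr_gt0.
have dd0 : 0 < d / 2 * d by exact: mulr_gt0.
have uq0 : 0 < `|u| * `|q| by rewrite mulr_gt0 ?normr_gt0.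
rewrite lef_pV2 ?posrE //.
by apply: ler_pM => //; exact: ltW.
Qed.

End Close.

Section StandardPart.
Variables (T : rcfType) (R : realType).
Implicit Types (u v : T) (s t : R) (e q r : rat).

(* t is the standard part of u. *)
Definition near_std u t : Prop := forall e, 0 < e ->
  exists q, `|u - ratr q| <= ratr e /\ `|t - ratr q| <= ratr e.

Lemma ratr_small t : 0 < t -> exists2 e : rat, 0 < e & ratr e < t.
Proof.
move=> /rat_in_itvoo[e]; rewrite in_itv /= => /andP[e0 et].
by exists e => //; rewrite -(ltr_rat R) rmorph0.
Qed.

Lemma ratr_bound t : exists2 B : rat, 0 <= B & `|t| <= ratr B.
Proof.
exists (Num.bound `|t|)%:R; first exact: ler0n.
by rewrite ratr_nat ltW // archi_boundP.
Qed.

Lemma near_std_rat q : near_std (ratr q) (ratr q).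
Proof. by move=> e e0; exists q; rewrite !subrr !normr0 !ler0q ltW. Qed.

Lemma near_std0 : near_std 0 0.
Proof. by have := near_std_rat 0; rewrite !rmorph0. Qed.

Lemma near_std1 : near_std 1 1.
Proof. by have := near_std_rat 1; rewrite !rmorph1. Qed.

Lemma near_std_int (c : int) : near_std c%:~R c%:~R.
Proof. by have := near_std_rat c%:~R; rewrite !ratr_int. Qed.

Lemma near_stdD u v t s : near_std u t -> near_std v s -> near_std (u + v) (t + s).
Proof.
move=> ut vs e e0; have e20 : 0 < e / 2 by rewrite divr_gt0.
have [q [uq tq]] := ut _ e20; have [r [vr sr]] := vs _ e20.
have e2 : e = e / 2 + e / 2 by field.
exists (q + r); split; rewrite rmorphD opprD addrACA.
  by rewrite [X in _ <= ratr X]e2 rmorphD (le_trans (ler_normD _ _)) // lerD.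
by rewrite [X in _ <= ratr X]e2 rmorphD (le_trans (ler_normD _ _)) // lerD.
Qed.

Lemma near_stdN u t : near_std u t -> near_std (- u) (- t).
Proof.
move=> ut e /ut [q [uq tq]]; exists (- q).
by rewrite !rmorphN -!opprD !normrN.
Qed.

Lemma near_stdB u v t s : near_std u t -> near_std v s -> near_std (u - v) (t - s).
Proof. by move=> ut vs; apply: near_stdD => //; exact: near_stdN. Qed.

Lemma near_stdM u v t s : near_std u t -> near_std v s -> near_std (u * v) (t * s).
Proof.
move=> ut vs e e0.
have [B1 B10 tB] := ratr_bound t; have [B2 B20 sB] := ratr_bound s.
pose B := B1 + B2 + 1; have B0 : 0 < 2 * B + 1 by rewrite /B; lra.
(* [d] makes the error bound of [close_mul] at most e; being at most 1, it also keeps both rational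
   approximations within B. *)
pose d := Num.min 1 (e / (2 * B + 1)).
have d0 : 0 < d by rewrite lt_min ltr01 divr_gt0.
have d1 : d <= 1 by rewrite ge_min lexx.
have dB : d * (2 * B + 1) <= e by rewrite -ler_pdivlMr // ge_min lexx orbT.
have [q [uq tq]] := ut _ d0; have [r [vr sr]] := vs _ d0.
have nB (x : R) z C : `|x - ratr z| <= ratr d -> `|x| <= ratr C -> C + 1 <= B ->
    `|ratr z : R| <= ratr B.
  move=> xz xC CB; rewrite -[X in `|X|](subKr x).
  rewrite (le_trans (ler_normB _ _)) //.
  rewrite (@le_trans _ _ (ratr (C + 1))) ?ler_rat // rmorphD /= lerD //.
  by rewrite (le_trans xz) // ler_rat.
have qB : `|q| <= B.
  by rewrite -(ler_rat R) ratr_norm (nB _ _ _ tq tB) // /B; lra.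
have rB : `|r| <= B.
  by rewrite -(ler_rat R) ratr_norm (nB _ _ _ sr sB) // /B; lra.
exists (q * r); split.
- rewrite rmorphM /= (@le_trans _ _ (ratr (d * (2 * B + 1)))) ?ler_rat //.
  rewrite rmorphM rmorphD rmorphM rmorph1 rmorph_nat /=.
  apply: close_mul => //; rewrite -?ratr_norm ?ler_rat //.
  by rewrite -[1](rmorph1 (@ratr T)) ler_rat.
- rewrite rmorphM /= (@le_trans _ _ (ratr (d * (2 * B + 1)))) ?ler_rat //.
  rewrite rmorphM rmorphD rmorphM rmorph1 rmorph_nat /=.
  apply: close_mul => //; rewrite -?ratr_norm ?ler_rat //.
  by rewrite -[1](rmorph1 (@ratr R)) ler_rat.
Qed.

Lemma near_std_gt0 u t : near_std u t -> 0 < t -> 0 < u.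
Proof.
move=> ut t0; have [e e0 et] : exists2 e : rat, 0 < e & ratr e < t / 2.
  by apply: ratr_small; rewrite divr_gt0.
have [q [uq tq]] := ut _ e0.
have qe : e < q.
  by rewrite -(ltr_rat R); move: tq; rewrite ler_norml => /andP[_]; lra.
by move: uq; rewrite -(ltr_rat T) in qe; rewrite ler_norml => /andP[]; lra.
Qed.

Lemma near_std_lt0 u t : near_std u t -> t < 0 -> u < 0.
Proof. by move=> /near_stdN ut; rewrite -oppr_gt0 -(oppr_gt0 u); exact: near_std_gt0. Qed.

Lemma near_std_uniq u t s : near_std u t -> near_std u s -> t = s.
Proof.
move=> ut us; have := near_stdB ut us; rewrite subrr => h.
apply/eqP; rewrite -subr_eq0; case: (ltgtP (t - s) 0) => // ts.
  by have := near_std_lt0 h ts; rewrite ltxx.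
by have := near_std_gt0 h ts; rewrite ltxx.
Qed.

Lemma near_stdV u t : t != 0 -> near_std u t -> near_std u^-1 t^-1.
Proof.
move=> t0 ut e e0; have [d d0 dt] : exists2 d : rat, 0 < d & ratr d < `|t| / 2.
  by apply: ratr_small; rewrite divr_gt0 ?normr_gt0.
(* The first bound keeps the approximation q away from 0, the second turns the error bound of
   [close_inv] into e. *)
pose c := Num.min (d / 2) (e / (2 / d ^+ 2)).
have c0 : 0 < c by rewrite lt_min !divr_gt0 ?exprn_gt0.
have cd : 2 * c <= d by rewrite mulrC -ler_pdivlMr // ge_min lexx.
have ce : c * (2 / d ^+ 2) <= e.
  by rewrite -ler_pdivlMr ?divr_gt0 ?exprn_gt0 // ge_min lexx orbT.
have [q [uq tq]] := ut _ c0.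
have dq : d <= `|q|.
  rewrite -(ler_rat R) ratr_norm.
  have : `|t| <= `|t - ratr q| + `|ratr q| by rewrite -{1}[t](subrK (ratr q)) ler_normD.
  have : ratr c <= ratr d / 2 :> R.
    by rewrite ler_pdivlMr // mulrC -[2](rmorph_nat (@ratr R)) -rmorphM ler_rat.
  have : 0 < ratr d :> R by rewrite ltr0q.
  by move: tq; lra.
exists q^-1; split.
- rewrite fmorphV (@le_trans _ _ (ratr (c * (2 / d ^+ 2)))) ?ler_rat //.
  rewrite !rmorphM fmorphV rmorphXn rmorph_nat /=; apply: close_inv => //.
  + by rewrite -[0](rmorph0 (@ratr T)) ltr_rat.
  + by rewrite -ratr_norm ler_rat.
  + by rewrite -[2](rmorph_nat (@ratr T)) -rmorphM ler_rat.
- rewrite fmorphV (@le_trans _ _ (ratr (c * (2 / d ^+ 2)))) ?ler_rat //.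
  rewrite !rmorphM fmorphV rmorphXn rmorph_nat /=; apply: close_inv => //.
  + by rewrite -[0](rmorph0 (@ratr R)) ltr_rat.
  + by rewrite -ratr_norm ler_rat.
  + by rewrite -[2](rmorph_nat (@ratr R)) -rmorphM ler_rat.
Qed.

Lemma near_std_close u v t :
  (forall e, 0 < e -> `|v - u| <= ratr e) -> near_std u t -> near_std v t.
Proof.
move=> vu ut.
have h : near_std (v - u) 0.
  move=> e e0; exists 0; rewrite !rmorph0 !subr0 normr0 ler0q (ltW e0).
  by split => //; exact: vu.
by have := near_stdD h ut; rewrite subrK add0r.
Qed.

(* Hensel: a simple root lifts along the standard part. *)
Lemma near_std_root (Q : {poly T}) (P : {poly R}) u0 t :
  (forall u s, near_std u s -> near_std Q.[u] P.[s]) ->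
  root P t -> P^`().[t] != 0 -> near_std u0 t ->
  exists2 u, root Q u & near_std u t.
Proof.
move=> QP Pt dPt u0t; have /factor_theorem[S PE] := Pt.
have St : S.[t] != 0.
  apply: contraNneq dPt => St; apply/eqP.
  by rewrite PE derivM derivXsubC mulr1 !hornerE St subrr mulr0 add0r.
(* Near t the cofactor S keeps the sign of its nonzero value at t, so P, which is S times X - t,
   changes sign at t. *)
have [d d0 dP] := @poly_cont R t S `|S.[t]| (etrans (normr_gt0 _) St).
have Ssgn y : `|y - t| < d -> 0 < S.[y] * S.[t].
  move=> /dP; have [S0|S0|S0] := ltgtP S.[t] 0; last by rewrite S0 eqxx in St.
    rewrite ltr_norml (ltr0_norm S0) => /andP[_ h].
    by rewrite nmulr_rgt0 //; move: h; lra.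
  rewrite ltr_norml (gtr0_norm S0) => /andP[h _].
  by rewrite pmulr_lgt0 //; move: h; lra.
have [e e0 ed] := ratr_small d0.
(* The sign change of P between t - c and t + c passes to Q along the standard part, and the
   intermediate value theorem gives a root of Q within c of u0. *)
have rootQ c : 0 < c -> c <= e -> Q != 0 /\ exists2 u, root Q u & `|u - u0| < ratr c.
  move=> c0 ce; have cR : 0 < ratr c :> R by rewrite ltr0q.
  have cT : 0 < ratr c :> T by rewrite ltr0q.
  have cd : ratr c < d by apply: le_lt_trans ed; rewrite ler_rat.
  have PP : P.[t - ratr c] * P.[t + ratr c] < 0.
    rewrite PE !hornerM !hornerXsubC.
    have -> : S.[t - ratr c] * (t - ratr c - t) * (S.[t + ratr c] * (t + ratr c - t)) =
        - (ratr c ^+ 2 * (S.[t - ratr c] * S.[t + ratr c])) by ring.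
    rewrite oppr_lt0 pmulr_rgt0 ?exprn_gt0 //.
    have S2 : 0 < S.[t] ^+ 2 by rewrite exprn_even_gt0 //=.
    rewrite -(pmulr_lgt0 _ S2).
    have -> : S.[t - ratr c] * S.[t + ratr c] * S.[t] ^+ 2 =
      (S.[t - ratr c] * S.[t]) * (S.[t + ratr c] * S.[t]) by ring.
    apply: mulr_gt0; apply: Ssgn.
      by rewrite addrAC subrr add0r normrN gtr0_norm.
    by rewrite addrAC subrr add0r gtr0_norm.
  have QQ : Q.[u0 - ratr c] * Q.[u0 + ratr c] < 0.
    apply: (near_std_lt0 _ PP); apply: near_stdM; apply: QP.
      by apply: near_stdB => //; exact: near_std_rat.
    by apply: near_stdD => //; exact: near_std_rat.
  split; first by apply: contraTneq QQ => ->; rewrite !horner0 mul0r ltxx.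
  have [|u] := poly_ivtoo _ QQ; first by move: cT; lra.
  rewrite in_itv /= => /andP[u1 u2] Qu; exists u => //.
  by rewrite ltr_norml; apply/andP; split; move: u1 u2; lra.
have Q0 : Q != 0 by have [] := rootQ e e0 (lexx e).
apply: contrapT => near_ex.
(* If no root of Q had standard part t, the finitely many roots would all keep a positive rational
   distance from u0, against the existence of roots arbitrarily close to u0. *)
have sep (l : seq T) : (forall u, u \in l -> root Q u) ->
    exists c, [/\ 0 < c, c <= e & forall u, u \in l -> ratr c <= `|u - u0|].
  elim: l => [|u l IH] lQ; first by exists e.
  have [|c [c0 ce cP]] := IH; first by move=> w wl; apply: lQ; rewrite inE wl orbT.
  have [b b0 bu] : exists2 b : rat, 0 < b & ratr b <= `|u - u0|.
    apply: contrapT => nb; apply: near_ex; exists u.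
      by apply: lQ; rewrite inE eqxx.
    apply: near_std_close u0t => b b0; rewrite leNgt; apply/negP => bu.
    by apply: nb; exists b => //; exact: ltW.
  exists (Num.min b c); split; rewrite ?lt_min ?b0 ?ge_min ?ce ?orbT // => w.
  rewrite inE => /predU1P[->|wl].
    by apply: le_trans bu; rewrite ler_rat ge_min lexx.
  by apply: le_trans (cP _ wl); rewrite ler_rat ge_min lexx orbT.
have [|c [c0 ce cP]] := sep (rootsR Q).
  by move=> u; rewrite -(roots_on_rootsR Q0) => /andP[].
have [_ [u Qu uc]] := rootQ _ c0 ce.
have := cP u; rewrite -(roots_on_rootsR Q0) in_itv Qu => /(_ isT).
by rewrite leNgt uc.
Qed.

End StandardPart.

Lemma inj_card_leT (S U : Type) (B : set U) (f : S -> U) :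
  (forall x, B (f x)) -> injective f -> [set: S] #<= B.
Proof.
move=> fB f_inj; suff /injfunPex[g] : exists2 f : S -> U,
    set_fun [set: S] B f & set_inj [set: S] f by exact: inj_card_le g.
by exists f => [x _|x y _ _ /f_inj]; [exact: fB|].
Qed.

(** * Subfields lifted along the standard part, and embeddings of the reals *)

Section LiftedFields.
Variables (T : rcfType) (R : realType).
Implicit Types (u v : T) (s t : R) (D : set T).

Notation near_std := (@near_std T R).

(* D is a subfield on which the standard part is defined and injective. *)
Record lifted D : Prop := Lifted {
  lifted1 : D 1;
  liftedB : forall u v, D u -> D v -> D (u - v);
  liftedV : forall u v, D u -> D v -> D (u / v);
  lifted_approx : forall u, D u -> exists t, near_std u t /\ (t = 0 -> u = 0) }.

Section LiftedFractions.
Variable rho : R -> T -> Prop.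
Hypothesis rho1 : rho 1 1.
Hypothesis rhoB : forall t s u v, rho t u -> rho s v -> rho (t - s) (u - v).
Hypothesis rhoM : forall t s u v, rho t u -> rho s v -> rho (t * s) (u * v).
Hypothesis rho_approx : forall t u, rho t u -> near_std u t.
Hypothesis rho0 : forall t u, rho t u -> t = 0 -> u = 0.

(** [rho] is the graph of an isomorphism between a subring of R and a subring of T that inverts the
    standard part; this is the fraction field of the latter inside T. *)
Definition fractions : set T :=
  [set w | exists t u s v, [/\ rho t u, rho s v & w = u / v]].

Lemma fractions_num t u : rho t u -> fractions u.
Proof. by move=> tu; exists t, u, 1, 1; split => //; rewrite divr1. Qed.

Lemma rho_nz t u : rho t u -> u != 0 -> t != 0.
Proof. by move=> tu; apply: contraNneq => t0; rewrite (rho0 tu t0). Qed.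

(** A nonzero denominator has a nonzero standard part by [rho0], so a quotient has the quotient of
    the standard parts as its own; a zero denominator gives the element 0. *)
Lemma lifted_fractions : lifted fractions.
Proof.
have rho00 : rho 0 0 by have := rhoB rho1 rho1; rewrite !subrr.
split.
- exact: fractions_num rho1.
- move=> _ _ [t [u [s [v [tu sv ->]]]]] [t' [u' [s' [v' [tu' sv' ->]]]]].
  have [v0|v0] := eqVneq v 0; last have [v'0|v'0] := eqVneq v' 0.
  + exists (0 * s - t'), (0 * v - u'), s', v'; split => //.
      by apply: rhoB => //; exact: rhoM.
    by rewrite v0 invr0 mulr0 mul0r !sub0r mulNr.
  + by exists t, u, s, v; split => //; rewrite v'0 invr0 mulr0 subr0.
  + exists (t * s' - t' * s), (u * v' - u' * v), (s * s'), (v * v'); split.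
    * by apply: rhoB; exact: rhoM.
    * exact: rhoM.
    * by field; rewrite v0 v'0.
- move=> _ _ [t [u [s [v [tu sv ->]]]]] [t' [u' [s' [v' [tu' sv' ->]]]]].
  exists (t * s'), (u * v'), (s * t'), (v * u'); split; [exact: rhoM..|].
  by rewrite invf_div mulf_div.
- move=> _ [t [u [s [v [tu sv ->]]]]].
  have [->|v0] := eqVneq v 0.
    by exists 0; rewrite invr0 mulr0; split=> //; exact: near_std0.
  have s0 := rho_nz sv v0; exists (t / s); split.
    by apply: near_stdM; [exact: rho_approx | apply: near_stdV => //; exact: rho_approx].
  move=> /eqP; rewrite mulf_eq0 invr_eq0 (negPf s0) orbF => /eqP.
  by move=> /(rho0 tu) ->; rewrite mul0r.
Qed.

End LiftedFractions.

Section GenericLift.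
Variables (L : fieldType) (st : {rmorphism L -> R}) (vl : {rmorphism L -> T}).
Hypothesis stP : forall x, near_std (vl x) (st x).

Lemma near_std_horner (r : {poly L}) u t :
  near_std u t -> near_std (map_poly vl r).[u] (map_poly st r).[t].
Proof.
move=> ut; elim/poly_ind: r => [|r c IH]; first by rewrite !rmorph0 !horner0; exact: near_std0.
rewrite !rmorphD !rmorphM /= !map_polyX !map_polyC !hornerE.
by apply: near_stdD; [exact: near_stdM | exact: stP].
Qed.

(** If t is transcendental over L, any u with standard part t works. Otherwise take a polynomial q
    of least size vanishing at t: its derivative is nonzero there by minimality, so Hensel's lemma
    gives a root u of q near t, and every r vanishing at t is a multiple of q. *)
Lemma lifted_generic t : (exists u, near_std u t) -> exists2 u, near_std u t &
  forall r : {poly L}, root (map_poly st r) t -> root (map_poly vl r) u.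
Proof.
move=> [u0 u0t].
have [[q0 q00 q0t]|nq] :=
  pselect (exists2 q : {poly L}, q != 0 & root (map_poly st q) t); last first.
  exists u0 => // r rt; have [->|r0] := eqVneq r 0; first by rewrite rmorph0 root0.
  by case: nq; exists r.
have ex_n : exists n, `[< exists q : {poly L},
    [/\ q != 0, root (map_poly st q) t & size q = n] >].
  by exists (size q0); apply/asboolP; exists q0.
case: (ex_minnP ex_n) => n /asboolP[q [qn0 qt qn]] nmin.
have qmin (r : {poly L}) : root (map_poly st r) t -> (size r < size q)%N -> r = 0.
  move=> rt; rewrite qn ltnNge; apply: contraNeq => r0.
  by apply: nmin; apply/asboolP; exists r.
have q1 : (1 < size q)%N.
  rewrite ltnNge; apply/negP => /size1_polyC qc.
  move: qt qn0; rewrite qc map_polyC rootC fmorph_eq0 => /eqP ->.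
  by rewrite polyC0 eqxx.
have dq : (map_poly st q)^`().[t] != 0.
  apply/negP => dq0; rewrite deriv_map in dq0.
  have dsz : size (map_poly st q^`()) = (size q).-1.
    by rewrite -deriv_map size_deriv size_map_poly.
  have := qmin _ dq0; rewrite -(size_map_poly st) dsz prednK ?(ltnW q1) // leqnn.
  move=> /(_ isT) dq; move: dsz; rewrite dq rmorph0 size_poly0.
  by case: (size q) q1 => [|[]].
have [u uq ut] := near_std_root (fun _ _ => @near_std_horner q _ _) qt dq u0t.
exists u => // r rt.
have rq : root (map_poly st (r %% q)) t.
  move: rt; rewrite {1}(divp_eq r q) rmorphD rmorphM /= !rootE !hornerE.
  by rewrite (rootP qt) mulr0 add0r.
have /eqP rq0 := qmin _ rq (etrans (ltn_modp _ _) qn0).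
rewrite (divp_eq r q) (eqP rq0) addr0 rmorphM /= rootE hornerE.
by rewrite (rootP uq) mulr0.
Qed.

End GenericLift.

Section LiftedExtension.
Variables (D : set T) (Dl : lifted D).
Hypothesis near_std_surj : forall t, exists u, near_std u t.

Definition lifted_divring : divringClosed T :=
  divring_of (lifted1 Dl) (liftedB Dl) (liftedV Dl).
Local Notation L := (subfield lifted_divring).

Lemma lifted_val (x : L) : D (val x).
Proof. by apply/(mem_divring_of (lifted1 Dl) (liftedB Dl) (liftedV Dl)); exact: valP. Qed.

Lemma lifted_st_ex (x : L) : {t : R | near_std (val x) t}.
Proof. by apply: cid; have [t []] := lifted_approx Dl (lifted_val x); exists t. Qed.

Definition lifted_st (x : L) : R := sval (lifted_st_ex x).

Lemma lifted_stP x : near_std (val x) (lifted_st x).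
Proof. exact: svalP. Qed.

Lemma lifted_stB : {morph lifted_st : x y / x - y}.
Proof.
move=> x y; apply: (near_std_uniq (lifted_stP _)).
by rewrite rmorphB; apply: near_stdB; exact: lifted_stP.
Qed.

Lemma lifted_stM : {morph lifted_st : x y / x * y}.
Proof.
move=> x y; apply: (near_std_uniq (lifted_stP _)).
by rewrite rmorphM; apply: near_stdM; exact: lifted_stP.
Qed.

Lemma lifted_st1 : lifted_st 1 = 1.
Proof. by apply: (near_std_uniq (lifted_stP _)); rewrite rmorph1; exact: near_std1. Qed.

Let st : {rmorphism L -> R} := rmorph_of lifted_st1 lifted_stB lifted_stM.
Let vl : {rmorphism L -> T} := val.

(** By [lifted_generic], sending r(t) to r(u) for r over D is well defined, and the fraction field
    of the values r(u) contains D and u. *)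
Lemma lifted_extend t : exists D', [/\ lifted D', D `<=` D' &
  exists2 u, D' u & near_std u t].
Proof.
have [u ut ug] := lifted_generic (st := st) (vl := vl) lifted_stP (near_std_surj t).
pose rho s v := exists r : {poly L},
  s = (map_poly st r).[t] /\ v = (map_poly vl r).[u].
have rhol : lifted (fractions rho).
  apply: lifted_fractions.
  - by exists 1; rewrite !rmorph1 !hornerE.
  - move=> _ _ _ _ [r [-> ->]] [r' [-> ->]]; exists (r - r').
    by rewrite !rmorphB /= !hornerE.
  - move=> _ _ _ _ [r [-> ->]] [r' [-> ->]]; exists (r * r').
    by rewrite !rmorphM /= !hornerE.
  - by move=> _ _ [r [-> ->]]; exact: (near_std_horner (st := st) (vl := vl) lifted_stP).
  - by move=> _ _ [r [-> ->]] /eqP /ug /eqP.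
have r1 : rho 1 1 by exists 1; rewrite !rmorph1 !hornerE.
exists (fractions rho); split => //.
- move=> v Dv.
  have vK : v \in lifted_divring by apply/mem_divring_of.
  apply: (@fractions_num rho r1 (st (Sub v vK : L))); exists (Sub v vK : L)%:P.
  by rewrite !map_polyC !hornerC.
- exists u => //; apply: (@fractions_num rho r1 t); exists 'X.
  by rewrite !map_polyX !hornerX.
Qed.

End LiftedExtension.

(** Zorn's lemma: a lifted field that misses a standard part t is not maximal, by
    [lifted_extend]. *)
Lemma lifted_maximal D0 : (forall t, exists u, near_std u t) -> lifted D0 ->
  exists2 D, lifted D /\ D0 `<=` D & forall t, exists2 u, D u & near_std u t.
Proof.
move=> surj D0l.
pose P := [set D | D = set0 \/ lifted D /\ D0 `<=` D].
have [|D [PD Dmax]] := @Zorn_bigcup T P.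
  move=> F FP Ftot.
  have [[D1 FD1 D1n]|Fn] := pselect (exists2 D, F D & D <> set0); last first.
    left; apply/seteqP; split=> // u [D FD Du]; case: Fn; exists D => //.
    by move=> D_0; rewrite D_0 in Du.
  have Fl D u : F D -> D u -> lifted D /\ D0 `<=` D.
    by move=> /FP[->|].
  have [D1l D01] : lifted D1 /\ D0 `<=` D1 by case: (FP _ FD1).
  have F2 u v : (\bigcup_(D in F) D) u -> (\bigcup_(D in F) D) v ->
      exists2 D, F D /\ lifted D & D u /\ D v.
    move=> [Du FDu Duu] [Dv FDv Dvv]; have [DD|DD] := Ftot _ _ FDu FDv.
      by exists Dv; [have [] := Fl _ _ FDv Dvv | split => //; exact: DD].
    by exists Du; [have [] := Fl _ _ FDu Duu | split => //; exact: DD].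
  right; split; last by move=> u /D01 D1u; exists D1.
  split.
  - by exists D1 => //; exact: lifted1.
  - move=> u v uF vF; have [D [FD Dl] [Du Dv]] := F2 _ _ uF vF.
    by exists D => //; exact: liftedB.
  - move=> u v uF vF; have [D [FD Dl] [Du Dv]] := F2 _ _ uF vF.
    by exists D => //; exact: liftedV.
  - by move=> u [D FD Du]; have [Dl _] := Fl _ _ FD Du; exact: lifted_approx Dl _ Du.
have [Dl D0D] : lifted D /\ D0 `<=` D.
  case: PD => // DE; exfalso; apply: (Dmax D0); last by right; split.
  by rewrite DE; split => // /(_ 1 (lifted1 D0l)).
exists D => // t.
have [D' [D'l DD' [u D'u ut]]] := lifted_extend Dl surj t.
have [Du|nDu] := pselect (D u); first by exists u.
exfalso; apply: (Dmax D'); last by right; split => // v /D0D /DD'.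
by split=> // /(_ _ D'u).
Qed.

(** The standard part is injective on D by [lifted_approx] and here also onto, so its inverse is a
    field embedding of R. *)
Lemma lifted_embedding D : lifted D -> (forall t, exists2 u, D u & near_std u t) ->
  exists f : {rmorphism R -> T}, forall u t, D u -> near_std u t -> f t = u.
Proof.
move=> Dl surj; pose g t := sval (cid2 (surj t)).
have gD t : D (g t) by rewrite /g; case: cid2.
have gt t : near_std (g t) t by rewrite /g; case: cid2.
have D_uniq u v t : D u -> D v -> near_std u t -> near_std v t -> u = v.
  move=> Du Dv ut vt; apply/eqP; rewrite -subr_eq0; apply/eqP.
  have [s [uvs]] := lifted_approx Dl (liftedB Dl Du Dv); apply.
  by apply: (near_std_uniq uvs); have := near_stdB ut vt; rewrite subrr.
have DM u v : D u -> D v -> D (u * v).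
  move=> Du Dv; rewrite -[v]invrK -[v^-1]mul1r; apply: (liftedV Dl) => //.
  by apply: (liftedV Dl) => //; exact: lifted1.
have g1 : g 1 = 1 by apply: (D_uniq _ _ 1) => //; [exact: lifted1 | exact: near_std1].
have gB : {morph g : t s / t - s}.
  move=> t s; apply: (D_uniq _ _ (t - s)) => //; first exact: liftedB.
  exact: near_stdB.
have gM : {morph g : t s / t * s}.
  move=> t s; apply: (D_uniq _ _ (t * s)) => //; first exact: DM.
  exact: near_stdM.
exists (rmorph_of g1 gB gM) => u t Du ut; exact: D_uniq ut.
Qed.

(* Distinct lifts of the algebraically independent reals [liou x] yield distinct
   embeddings. *)
Lemma many_embeddings (E : fieldType) (j : {rmorphism T -> E}) (eps : T) :
  (forall t, exists u, near_std u t) -> eps != 0 -> near_std eps 0 ->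
  [set: set (set nat)] #<= embeddings R E.
Proof.
move=> surj eps0 epsP.
pose b := liou R; pose c0 x := sval (cid (surj (b x))).
have c0P x : near_std (c0 x) (b x) by rewrite /c0; case: cid.
(* The embedding codes S: the lift of [b x] is shifted by the infinitesimal [eps] exactly when x
   belongs to S. *)
have embS (S : set (set nat)) : {f : {rmorphism R -> T} |
    forall x, f (b x) = c0 x + (`[< S x >])%:R * eps}.
  apply: cid; pose c x := c0 x + (`[< S x >])%:R * eps.
  have cP x : near_std (c x) (b x).
    rewrite -[b x]addr0; apply: near_stdD => //.
    by case: asbool; rewrite ?mul1r ?mul0r //; exact: near_std0.
  (* Algebraic independence of the reals [b x] makes this a well-defined map for any choice of
     lifts. *)
  pose rho t u := exists e : expr (set nat), t = ev b e /\ u = ev c e.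
  have rhol : lifted (fractions rho).
    apply: lifted_fractions.
    - by exists (ECst _ 1).
    - move=> _ _ _ _ [e [-> ->]] [e' [-> ->]].
      exists (EAdd e (EMul (ECst _ (-1)) e')).
      by rewrite /= !mulN1r.
    - by move=> _ _ _ _ [e [-> ->]] [e' [-> ->]]; exists (EMul e e').
    - move=> _ _ [e [-> ->]].
      elim: e => [x|z|e1 IH1 e2 IH2|e1 IH1 e2 IH2] /=; first exact: cP.
      + exact: near_std_int.
      + exact: near_stdD.
      + exact: near_stdM.
    - move=> _ _ [e [-> ->]] /liou_independent e0.
      exact: e0 (@char0_numDomain T).
  have [D [Dl sD] Dsurj] := lifted_maximal surj rhol.
  have [f fP] := lifted_embedding Dl Dsurj; exists f => x.
  apply: fP (cP x); apply: sD.
  apply: (@fractions_num rho _ (b x)); last by exists (EVar x).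
  by exists (ECst _ 1).
apply: (@inj_card_leT _ _ _ (fun S => j \o sval (embS S))).
  by move=> S; exists (j \o sval (embS S) : {rmorphism R -> E}).
move=> S S' SS'.
have {}SS' x : `[< S x >] = `[< S' x >].
  have := congr1 (fun f => f (b x)) SS'; rewrite /= => /fmorph_inj.
  rewrite (svalP (embS S)) (svalP (embS S')) => /addrI /(mulIf eps0) /eqP.
  by case: (asbool (S x)); case: (asbool (S' x)); rewrite //= ?oner_eq0 // eq_sym oner_eq0.
by apply/seteqP; split=> x /asboolP; [rewrite SS'|rewrite -SS'] => /asboolP.
Qed.

End LiftedFields.

(** * Internal sets as ultraproducts *)

Lemma Vlift_inj X n : injective (@Vlift X n).
Proof.
elim: n => [|n IH] x y; first by move=> [].
case: x y => [u|A] [v|B] //= []; first by move=> ->.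
move=> AB; congr inr; rewrite predeqE => z.
by rewrite -(image_inj (A := A) IH) AB image_inj.
Qed.

Section InternalSets.
Variables (I : Type) (F : set_system I) (FU : UltraFilter F).

Let FF : Filter F := @filter_filter _ _ (@ultra_proper _ _ FU).
Local Existing Instance FF.

Lemma ultra_not (A : set I) : F A -> ~ F (~` A).
Proof.
move=> FA FnA; apply: (@filter_not_empty _ _ (@ultra_proper _ _ FU)).
by apply: filterS2 FA FnA => i.
Qed.

Lemma ultra_or (A B : set I) : F (A `|` B) -> F A \/ F B.
Proof.
move=> FAB; have [|FnA] := @in_ultra_setVsetC _ _ A FU; [by left|right].
by apply: filterS2 FAB FnA => i [].
Qed.

(** The existential case of transfer: witnesses are chosen index by index, with [u0] as the value
    where there is none. *)
Lemma ultra_choice (U : Type) (u0 : U) (P : I -> U -> Prop) :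
  F [set i | exists u, P i u] -> exists a, F [set i | P i (a i)].
Proof.
move=> FP; exists (fun i => if pselect (exists u, P i u) is left h
  then sval (cid h) else u0).
by apply: filterS FP => i /= ?; case: pselect => // h; exact: svalP.
Qed.

Lemma ultra_all_le (n : nat) (P : I -> nat -> Prop) :
  (forall k, (k < n)%N -> F [set i | P i k]) ->
  F [set i | forall k, (k < n)%N -> P i k].
Proof.
elim: n => [|n IH] h; first by apply: filterS filterT.
apply: filterS2 (IH (fun k kn => h k (ltnW kn))) (h n (ltnSn n)) => i /= hn Pn k.
by rewrite ltnS leq_eqVlt => /predU1P[->|/hn].
Qed.

Lemma Vultra_set n (a : I -> set (Vlevel nat n)) :
  Vultra FU (fun i => Vset (a i)) =
  Vset [set Vultra FU b | b in [set b | F [set i | a i (b i)]]].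
Proof.
rewrite /=; case: asboolP => //= h; exfalso.
by apply: ultra_not h _; apply: filterS filterT => i _ [].
Qed.

Lemma Vultra_ext n (a b : I -> Vlevel nat n) :
  F [set i | a i = b i] -> Vultra FU a = Vultra FU b.
Proof.
case: n a b => [|n] a b ab /=; first exact/starN_ofP.
have atomE : F [set i | exists u, a i = inl u] <-> F [set i | exists u, b i = inl u].
  by split=> h; apply: filterS2 ab h => i /= -> .
rewrite (asbool_equiv_eq atomE); case: ifP => _.
  by congr inl; apply/starN_ofP; apply: filterS ab => i /= ->.
congr inr; apply/seteqP; split=> _ [c cP <-]; exists c => //.
  by apply: filterS2 ab cP => i /= ->.
by apply: filterS2 ab cP => i /= <-.
Qed.

(** Induction on the level. If [a i] is not included in [b i] for F-most i, the witnesses form an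
    element of the collapse of a; it is also the collapse of a sequence taken from b, which by
    induction agrees with the witnesses almost everywhere, a contradiction. *)
Lemma Vultra_inj n (a b : I -> Vlevel nat n) :
  Vultra FU a = Vultra FU b -> F [set i | a i = b i].
Proof.
elim: n a b => [|n IH] a b; first by move=> /starN_ofP.
rewrite /=; case: asboolP => [ha|ha]; case: asboolP => [hb|hb] //.
  move=> [] /starN_ofP ab.
  by apply: filterS3 ha hb ab => i /= [u ->] [v ->] ->.
move=> [] ab.
have sub (c d : I -> Vlevel nat n.+1) :
    [set Vultra FU e | e in [set e | F [set i | Vmem (e i) (c i)]]] `<=`
    [set Vultra FU e | e in [set e | F [set i | Vmem (e i) (d i)]]] ->
    F [set i | forall e, Vmem e (c i) -> Vmem e (d i)].
  move=> cd; apply: contrapT => nF.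
  have [//|Fn] := @in_ultra_setVsetC _ _
    [set i | forall e, Vmem e (c i) -> Vmem e (d i)] FU.
  have [|e eP] := @ultra_choice (Vlevel nat n) (Vatom n 0%N)
    (fun i e => Vmem e (c i) /\ ~ Vmem e (d i)).
    apply: filterS Fn => i /= /existsNP[e /not_implyP he]; by exists e.
  have [|e' e'P] := cd (Vultra FU e).
    by exists e => //; apply: filterS eP => i [].
  move=> /IH e'e; apply: (@filter_not_empty _ _ (@ultra_proper _ _ FU)).
  by apply: filterS3 eP e'P e'e => i /= [_ +] + E; rewrite E.
have na (c : I -> Vlevel nat n.+1) : ~ F [set i | exists u, c i = inl u] ->
    F [set i | exists A, c i = inr A].
  have [//|h _] := @in_ultra_setVsetC _ _ [set i | exists u, c i = inl u] FU.
  by apply: filterS h => i /=; case: (c i) => [u|A] h; [case: h; exists u|exists A].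
have s1 : F [set i | forall e, Vmem e (a i) -> Vmem e (b i)] by apply: sub; rewrite ab.
have s2 : F [set i | forall e, Vmem e (b i) -> Vmem e (a i)] by apply: sub; rewrite ab.
apply: filterS2 (filterI (na _ ha) (na _ hb)) (filterI s1 s2) => i /=.
move=> [[A ->] [B ->]] [AB BA]; congr inr; apply/seteqP; split=> e.
  exact: AB.
exact: BA.
Qed.

Lemma Vlift_Vultra n (a : I -> Vlevel nat n) :
  Vlift (Vultra FU a) = Vultra FU (fun i => Vlift (a i)).
Proof.
elim: n a => [|n IH] a.
  rewrite /=; case: asboolP => // h; exfalso; apply: h.
  by apply: filterS filterT => i _; exists (a i).
have atomE : F [set i | exists u, a i = inl u] <->
    F [set i | exists u, Vlift (a i) = inl u].
  by split; apply: filterS => i /=; case: (a i) => [u|A] [v] //; exists u.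
rewrite [in RHS]/= -(asbool_equiv_eq atomE) [in LHS]/=; case: asboolP => h /=.
  congr inl; apply/starN_ofP; apply: filterS h => i /= [u ->] //.
congr inr; apply/seteqP; split=> [_ [_ [b bP <-] <-]|_ [c cP <-]].
  rewrite IH; exists (fun i => Vlift (b i)) => //.
  by apply: filterS bP => i /=; case: (a i) => //= A Ab; exists (b i).
have [|b bP] := @ultra_choice (Vlevel nat n) (Vatom n 0%N)
    (fun i e => Vmem e (a i) /\ c i = Vlift e).
  apply: filterS cP => i /=; case: (a i) => //= A [e Ae <-]; by exists e.
exists (Vultra FU b); first by exists b => //; apply: filterS bP => i [].
by rewrite IH; apply: (Vultra_ext (n := n.+1)); apply: filterS bP => i [_ ci]; exact: esym.
Qed.

(** Internality is tested at a higher level of the superstructure; this brings a representing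
    sequence back down to the level of x. *)
Lemma Vultra_unlift n (x : Vlevel (starN FU) n) (b : I -> Vlevel nat n.+1) :
  Vlift x = Vultra FU b -> exists b', x = Vultra FU b'.
Proof.
elim: n x b => [|n IH] x b.
  by rewrite /=; case: ifP => // _ [->]; eexists.
case: x => [u|A].
  rewrite [in LHS]/= [in RHS]/=; case: ifP => // _ [->].
  pose c i := if b i is inl v then v else 0%N; exists (fun i => inl (c i)).
  rewrite /=; case: asboolP => // h; exfalso; apply: h.
  by apply: filterS filterT => i _; exists (c i).
rewrite [in LHS]/= [in RHS]/=; case: ifP => // _ [AE].
(* Only the elements of [b i] that come from the lower level are kept; as all members of the
   represented set are lifts, none is lost. *)
exists (fun i => Vset [set z | Vmem (Vlift z) (b i)]).
rewrite Vultra_set; congr inr; apply/seteqP; split=> [x Ax|_ [c cP <-]].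
  have : (@Vlift _ n @` A) (Vlift x) by exists x.
  rewrite AE => -[d dP dx]; have [c cE] := IH _ _ (esym dx).
  exists c => //; move: dx; rewrite cE Vlift_Vultra => /(@Vultra_inj n.+1) dc.
  by apply: filterS2 dP dc => i /= + <-.
have : (@Vlift _ n @` A) (Vultra FU (fun i => Vlift (c i))).
  by rewrite AE; exists (fun i => Vlift (c i)).
move=> [y Ay yE]; have [e eE] := IH _ _ yE.
move: yE; rewrite eE Vlift_Vultra => /(@Vultra_inj n.+1) ec.
suff <- : y = Vultra FU c by [].
by rewrite eE; apply: Vultra_ext; apply: filterS ec => i /Vlift_inj.
Qed.

(** The ultraproduct of the sets [s i]. By [internal_istar] and [internal_setP] these are exactly
    the internal subsets of the hypernaturals. *)
Definition istar (s : I -> set nat) : set (starN FU) :=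
  [set x | F [set i | s i (repr x i)]].

Lemma istar_of s a : istar s (starN_of FU a) <-> F [set i | s i (a i)].
Proof.
by split=> h; apply: filterS2 (repr_starN_of FU a) h => i /= ->.
Qed.

Lemma istar_image s : istar s = [set starN_of FU b | b in [set b | F [set i | s i (b i)]]].
Proof.
apply/seteqP; split=> [x sx|_ [b bP <-]]; last exact/istar_of.
by exists (repr x) => //; exact: starN_ofK.
Qed.

Lemma internal_Vultra n (a : I -> Vlevel nat n) : internal (Vultra FU a).
Proof.
exists 0%N, (Vset setT); rewrite /star Vultra_set.
by exists a => //; apply: filterS filterT.
Qed.

Lemma internal_istar s : internal_set (istar s).
Proof.
rewrite /internal_set istar_image -(Vultra_set (n := 0) s).
exact: internal_Vultra.
Qed.

Lemma internal_setP S : internal_set S -> exists s, S = istar s.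
Proof.
move=> [k [A]]; rewrite /star /=; case: ifP => // _ [b _] bE.
have unlifts j (c : I -> Vlevel nat (j + 1)) :
    Vultra FU c = Vlifts j (@Vset (starN FU) 0 S) ->
    exists c' : I -> Vlevel nat 1, Vultra FU c' = @Vset (starN FU) 0 S.
  elim: j c => [|j IH] c; first by exists c.
  by move=> /esym /Vultra_unlift [c' /esym]; exact: IH.
have [c] := unlifts _ _ bE; rewrite /=; case: ifP => // _ [SE].
(* The indices at which c has an atom do not form an F-large set, so the empty set may stand
   there. *)
exists (fun i => if c i is inr B then B else set0).
rewrite istar_image -SE; apply/seteqP; split=> _ [d dP <-]; exists d => //.
  by apply: filterS dP => i /=; case: (c i).
by apply: filterS dP => i /=; case: (c i).
Qed.

Lemma Vpair_inj X n (x y x' y' : Vlevel X n) :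
  Vpair x y = Vpair x' y' -> x = x' /\ y = y'.
Proof.
move=> [] E.
have E1 : [set Vset [set x']; Vset [set x'; y']] (Vset [set x]) by rewrite -E; left.
have E2 : [set Vset [set x']; Vset [set x'; y']] (Vset [set x; y]) by rewrite -E; right.
have E3 : [set Vset [set x]; Vset [set x; y]] (Vset [set x'; y']) by rewrite E; right.
have xx : x = x'.
  have : [set x] x' by case: E1 => -[->] //; left.
  by [].
subst x'; split => //.
have yy' : y = x \/ y = y'.
  have : [set x; y] y by right.
  by case: E2 => -[->]; [left|case; [left|right]].
have y'y : y' = x \/ y' = y.
  have : [set x; y'] y' by right.
  by case: E3 => -[->]; [left|case; [left|right]].
by case: yy' => // yx; case: y'y => ->; rewrite ?yx.
Qed.

Lemma Vultra_set1 n (a : I -> Vlevel nat n) :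
  Vultra FU (fun i => Vset [set a i]) = Vset [set Vultra FU a].
Proof.
rewrite Vultra_set; congr inr; apply/seteqP; split=> [_ [b bP <-]|_ ->].
  exact: Vultra_ext.
by exists a => //; apply: filterS filterT.
Qed.

Lemma Vultra_set2 n (a b : I -> Vlevel nat n) :
  Vultra FU (fun i => Vset [set a i; b i]) = Vset [set Vultra FU a; Vultra FU b].
Proof.
rewrite Vultra_set; congr inr; apply/seteqP; split=> [_ [c cP <-]|_ [->|->]].
- by case: (ultra_or cP) => h; [left|right]; exact: Vultra_ext.
- by exists a => //; apply: filterS filterT => i _; left.
- by exists b => //; apply: filterS filterT => i _; right.
Qed.

Lemma Vultra_pair n (a b : I -> Vlevel nat n) :
  Vultra FU (fun i => Vpair (a i) (b i)) = Vpair (Vultra FU a) (Vultra FU b).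
Proof. by rewrite /Vpair Vultra_set2 Vultra_set1 Vultra_set2. Qed.

Section Levels.
Variable A : nat -> I -> set nat.
Hypothesis A_mono : forall m i, A m i `<=` A m.+1 i.

Definition limit_set : set (starN FU) := [set x | exists m, istar (A m) x].

Lemma limit_set_sigma : sigma_set limit_set.
Proof.
exists (fun m => istar (A m)); split; first by move=> m; exact: internal_istar.
by apply/seteqP; split=> [x [m Amx]|x [m _ Amx]]; exists m.
Qed.

Let first_level i (a m : nat) := A m i a /\ forall l, (l < m)%N -> ~ A l i a.

(** The rank of x, the least m with x in the m-th level, is an internal function because it is
    computed index by index. The limit set consists of the elements whose rank is at most a standard
    number, and such hypernaturals form a cut. *)
Lemma limit_set_almost_internal : almost_internal limit_set.
Proof.
have A_le m l i : (m <= l)%N -> A m i `<=` A l i.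
  by move=> /subnK <-; elim: (l - m)%N => //= j IH a /IH; exact: A_mono.
pose f : set (Vlevel (starN FU) 2) :=
  [set Vultra FU c | c in [set c : I -> Vlevel nat 2 |
     F [set i | exists a m, c i = Vpair (n := 0) a m /\ first_level i a m]]].
have fE a m : f (@Vpair _ 0 (starN_of FU a) (starN_of FU m)) <->
    F [set i | first_level i (a i) (m i)].
  rewrite -(Vultra_pair (n := 0) a m); split=> [[c cP /Vultra_inj ca]|h].
    apply: filterS2 cP ca => i /= [a' [m' [-> h]]] /(@Vpair_inj nat 0)[<- <-] //.
  exists (fun i => Vpair (n := 0) (a i) (m i)) => //.
  by apply: filterS h => i h; exists (a i), (m i).
exists 0%N, f, [set y | exists n, starN_rel leq y (starN_of FU (fun=> n))]; split.
- split=> [_ [c cP <-]|x y y'].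
    have [a aP] := @ultra_choice nat 0%N _ cP.
    have [m mP] := @ultra_choice nat 0%N _ aP.
    exists (starN_of FU a), (starN_of FU m).
    rewrite -(Vultra_pair (n := 0) a m); apply: Vultra_ext.
    by apply: filterS mP => i [].
  rewrite /= -[x]starN_ofK -[y]starN_ofK -[y']starN_ofK => /fE h1 /fE h2.
  apply/starN_ofP; apply: filterS2 h1 h2 => i /= [A1 m1] [A2 m2].
  apply/eqP; rewrite eqn_leq; apply/andP; split; rewrite leqNgt; apply/negP.
    by move=> /m1.
  by move=> /m2.
- have -> : Vset f = Vultra FU (fun i => @Vset nat 2
      [set c | exists a m, c = Vpair (n := 0) a m /\ first_level i a m]).
    by rewrite Vultra_set.
  exact: internal_Vultra.
- move=> x y [n yn] xy; exists n; move: yn xy.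
  rewrite -[x]starN_ofK -[y]starN_ofK => /starN_relP yn /starN_relP xy.
  by apply/starN_relP; apply: filterS2 xy yn => i /=; exact: leq_trans.
- rewrite /= image_id; apply/seteqP; split=> x /=.
    move=> [n nx]; have [|m mP] := @ultra_choice nat 0%N
      (fun i m => (m <= n)%N /\ first_level i (repr x i) m).
      apply: filterS nx => i /= Ai.
      have ex_m : exists m, `[< A m i (repr x i) >] by exists n; apply/asboolP.
      case: (ex_minnP ex_m) => m /asboolP Am mmin; exists m.
      split; first by apply: mmin; apply/asboolP.
      by split=> // l lm Al; move: lm; rewrite ltnNge mmin //; apply/asboolP.
    exists (starN_of FU m).
      by exists n; apply/starN_relP; apply: filterS mP => i [].
    by rewrite -[x]starN_ofK; apply/fE; apply: filterS mP => i [].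
  move=> [y [n yn]]; move: yn; rewrite -[x]starN_ofK -[y]starN_ofK.
  move=> /starN_relP yn /fE h; exists n; apply/istar_of.
  by apply: filterS2 yn h => i /= yn [h _]; exact: A_le yn _ h.
Qed.

End Levels.
End InternalSets.

(** * Overspill from countable incompleteness *)

Section Saturation.
Variables (I : Type) (F : set_system I) (FU : UltraFilter F).
Hypothesis F_incomplete : countably_incomplete F.

Let FF : Filter F := @filter_filter _ _ (@ultra_proper _ _ FU).
Local Existing Instance FF.

(** [v i] is the largest N such that i lies in [U k] and [A k] for all k up to N. It exists for
    F-most i because the intersection of the [A n] is not F-large, and it is at least n on the
    F-large set where the conditions up to n hold. *)
Lemma ultra_overspill (U : nat -> set I) : (forall n, F (U n)) ->
  exists2 v : I -> nat, F [set i | U (v i) i] & forall n, F [set i | (n <= v i)%N].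
Proof.
have [A [FA FnA]] := F_incomplete => FUn.
pose P n i := forall k, (k < n.+1)%N -> U k i /\ A k i.
have FP n : F [set i | P n i].
  by apply: ultra_all_le => k _; apply: filterI.
have [|v vP] := @ultra_choice I F FU nat 0%N
  (fun i N => P N i /\ forall n, P n i -> (n <= N)%N).
  have [//|FnA'] := @in_ultra_setVsetC _ _ (\bigcap_n A n) FU.
  apply: filterS2 FnA' (FP 0%N) => i /= nA P0.
  have [k nAk] : exists k, ~ A k i.
    by apply/existsNP => h; apply: nA => k _; exact: h.
  have ex_n : exists n, `[< P n i >] by exists 0%N; apply/asboolP.
  have ub n : `[< P n i >] -> (n <= k)%N.
    move=> /asboolP Pn; rewrite leqNgt; apply/negP => kn; apply: nAk.
    by have [] := Pn k (ltnW kn).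
  case: (ex_maxnP ex_n ub) => N /asboolP PN Nmax; exists N; split => // n Pn.
  by apply: Nmax; apply/asboolP.
exists v; first by apply: filterS vP => i /= [PN _]; have [] := PN _ (ltnSn _).
by move=> n; apply: filterS2 vP (FP n) => i /= [_ h] /h.
Qed.

End Saturation.

(** * An enumeration of the real algebraic numbers and its closure bounds *)

Section Enumeration.
Implicit Types (z w : realalg) (s : seq realalg) (q : {poly realalg}).

Definition pickle_seq (n : nat) : seq realalg :=
  [seq odflt 0 (unpickle k) | k <- iota 0 n].

Lemma mem_pickle_seq n z : (pickle z < n)%N -> z \in pickle_seq n.
Proof.
by move=> zn; apply/mapP; exists (pickle z); rewrite ?mem_iota // pickleK.
Qed.

Definition pickle_bound s : nat := \max_(z <- s) (pickle z).+1.

Lemma pickle_boundP s z : z \in s -> (pickle z < pickle_bound s)%N.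
Proof. by move=> zs; rewrite /pickle_bound; exact: leq_bigmax_seq. Qed.

Fixpoint seqs_over s (l : nat) : seq (seq realalg) :=
  if l is l'.+1 then [seq z :: c | z <- s, c <- seqs_over s l'] else [:: [::]].

Lemma mem_seqs_over s (c : seq realalg) : {subset c <= s} -> c \in seqs_over s (size c).
Proof.
elim: c => //= z c IH cs; apply: allpairs_f; first by apply: cs; rewrite inE eqxx.
by apply: IH => w wc; apply: cs; rewrite inE wc orbT.
Qed.

Definition pickle_next (n : nat) : seq realalg :=
  let s := pickle_seq n in
  [seq z + w | z <- s, w <- s] ++ [seq z * w | z <- s, w <- s] ++
  [seq - z | z <- s] ++ [seq z^-1 | z <- s] ++
  flatten [seq rootsR (Poly c) | l <- iota 0 n.+1, c <- seqs_over s l].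

(** A bound on the codes after one field operation or root extraction. The added n makes the bounds
    increase; the size allowed for polynomials grows with n, so that an infinite n covers every
    standard degree. *)
Definition pickle_step (n : nat) : nat := (n + pickle_bound (pickle_next n))%N.

Lemma pickle_step_ge n : (n <= pickle_step n)%N.
Proof. exact: leq_addr. Qed.

Lemma pickle_stepD n z w : (pickle z < n)%N -> (pickle w < n)%N ->
  (pickle (z + w)%R < pickle_step n)%N.
Proof.
move=> /mem_pickle_seq zs /mem_pickle_seq ws; rewrite /pickle_step ltn_addl //.
by apply: pickle_boundP; rewrite !mem_cat allpairs_f.
Qed.

Lemma pickle_stepM n z w : (pickle z < n)%N -> (pickle w < n)%N ->
  (pickle (z * w)%R < pickle_step n)%N.
Proof.
move=> /mem_pickle_seq zs /mem_pickle_seq ws; rewrite /pickle_step ltn_addl //.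
by apply: pickle_boundP; rewrite !mem_cat [X in _ || (X || _)]allpairs_f ?orbT.
Qed.

Lemma pickle_stepN n z : (pickle z < n)%N -> (pickle (- z)%R < pickle_step n)%N.
Proof.
move=> /mem_pickle_seq zs; rewrite /pickle_step ltn_addl //.
by apply: pickle_boundP; rewrite !mem_cat [X in [|| _, _, X | _]]map_f ?orbT.
Qed.

Lemma pickle_stepV n z : (pickle z < n)%N -> (pickle (z^-1)%R < pickle_step n)%N.
Proof.
move=> /mem_pickle_seq zs; rewrite /pickle_step ltn_addl //.
by apply: pickle_boundP; rewrite !mem_cat [X in [|| _, _, _, X | _]]map_f ?orbT.
Qed.

Lemma pickle_step_root n q z : q != 0 -> (size q <= n)%N ->
  (forall c, c \in (q : seq realalg) -> (pickle c < n)%N) -> root q z ->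
  (pickle z < pickle_step n)%N.
Proof.
move=> q0 qn qc qz; rewrite /pickle_step ltn_addl //; apply: pickle_boundP.
rewrite /pickle_next; do 4 (rewrite mem_cat; apply/orP; right).
apply/flattenP; exists (rootsR (Poly q)); last first.
  by rewrite polyseqK -(roots_on_rootsR q0) in_itv.
apply/allpairsPdep; exists (size q), (q : seq realalg); split => //.
  by rewrite mem_iota.
by apply: mem_seqs_over => c /qc /mem_pickle_seq.
Qed.

End Enumeration.

(** Levels on which [phi] can be applied index by index. Each operation moves one level up;
    [level_hom] makes representatives of the values of [phi] respect sums and products at almost
    every index, and [level_sat] places a term of infinite index of any standard sequence in the
    lowest level. *)
Record level_system (I : Type) (F : set_system I) (FU : UltraFilter F)
    (p : starN FU) (pP : star_prime p) (phi : realalg -> Fhat pP)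
    (L : nat -> I -> set realalg) : Prop := LevelSystem {
  level_mono : forall m i, L m i `<=` L m.+1 i;
  levelD : forall m i z w, L m i z -> L m i w -> L m.+1 i (z + w);
  levelM : forall m i z w, L m i z -> L m i w -> L m.+1 i (z * w);
  levelN : forall m i z, L m i z -> L m.+1 i (- z);
  levelV : forall m i z, L m i z -> L m.+1 i z^-1;
  level_root : forall m n, F [set i | forall (q : {poly realalg}) z, q != 0 ->
    (size q <= n)%N -> (forall c, c \in (q : seq realalg) -> L m i c) ->
    root q z -> L m.+1 i z];
  level_hom : forall m, F [set i | forall z w, L m i z -> L m i w ->
    let ph z := repr (Fhat_val (phi z)) i in
    ph (z + w) = (ph z + ph w)%N %[mod repr p i] /\
    ph (z * w) = (ph z * ph w)%N %[mod repr p i]];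
  level_std : forall z, F [set i | L 0 i z];
  level_sat : forall w : nat -> realalg, exists2 v : I -> nat,
    F [set i | L 0 i (w (v i))] & forall n, F [set i | (n <= v i)%N] }.

Section LevelSystemExists.
Variables (I : Type) (F : set_system I) (FU : UltraFilter F).
Hypothesis F_incomplete : countably_incomplete F.
Variables (p : starN FU) (pP : star_prime p).
Variable phi : {rmorphism realalg -> Fhat pP}.

Let FF : Filter F := @filter_filter _ _ (@ultra_proper _ _ FU).
Local Existing Instance FF.

(** Level m at index i consists of the numbers with code below the m-fold iterate of [pickle_step]
    at [h i], where [h] is infinite and obtained by overspill. *)
Lemma level_system_ex : exists L, level_system phi L.
Proof.
pose ph i z := repr (Fhat_val (phi z)) i.
have phE z : Fhat_of pP (ph^~ z) = phi z by exact: Fhat_ofK.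
pose hom i z w := ph i (z + w) = (ph i z + ph i w)%N %[mod repr p i] /\
                  ph i (z * w) = (ph i z * ph i w)%N %[mod repr p i].
have Fhom z w : F [set i | hom i z w].
  apply: filterI; apply/(Fhat_ofP pP).
    by rewrite -Fhat_addE !phE rmorphD.
  by rewrite -Fhat_mulE !phE rmorphM.
have Fhoms n : F [set i | forall z w, (pickle z < n)%N -> (pickle w < n)%N -> hom i z w].
  pose e k : realalg := odflt 0 (unpickle k).
  have : F [set i | forall j, (j < n)%N -> forall k, (k < n)%N -> hom i (e j) (e k)].
    by do 2 (apply: ultra_all_le => ? _).
  apply: filterS => i /= h z w zn wn.
  by have := h _ zn _ wn; rewrite /e !pickleK.
have step_le m n k : (n <= iter m pickle_step k)%N -> (n <= iter m.+1 pickle_step k)%N.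
  by move=> /leq_trans; apply; exact: pickle_step_ge.
have iter_le m m' k : (m <= m')%N -> (iter m pickle_step k <= iter m' pickle_step k)%N.
  by move=> /subnK <-; elim: (m' - m)%N => // j IH; rewrite addSn; exact: step_le.
(* Diagonal choice: the homomorphism laws are required up to the n-fold iterate at n, so that with
   an infinite h they hold on every standard level. *)
have [h hhom hinf] := ultra_overspill FU F_incomplete
  (fun n => Fhoms (iter n pickle_step n)).
exists (fun m i z => (pickle z < iter m pickle_step (h i))%N); split.
- by move=> m i z /=; exact: step_le.
- by move=> m i z w; exact: pickle_stepD.
- by move=> m i z w; exact: pickle_stepM.
- by move=> m i z; exact: pickle_stepN.
- by move=> m i z; exact: pickle_stepV.
- move=> m n; apply: filterS (hinf n) => i /= nh q z q0 qn qc.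
  apply: pickle_step_root => //; apply: (leq_trans qn); apply: (leq_trans nh).
  exact: (iter_le 0%N m).
- move=> m; apply: filterS2 hhom (hinf m) => i /= hi mh z w zL wL.
  by apply: hi; [apply: leq_trans zL _ | apply: leq_trans wL _]; exact: iter_le.
- by move=> z; exact: hinf.
- move=> w; apply: (ultra_overspill FU F_incomplete
    (U := fun k => [set i | (pickle (w k) < h i)%N])) => n.
  exact: hinf.
Qed.

End LevelSystemExists.

(** * The real closed field of reductions *)

Section HyperAlgebraic.
Variables (I : Type) (F : set_system I) (FU : UltraFilter F).
Variables (p : starN FU) (pP : star_prime p).
Variable phi : {rmorphism realalg -> Fhat pP}.
Variable L : nat -> I -> set realalg.
Hypothesis Ls : level_system phi L.

Let FF : Filter F := @filter_filter _ _ (@ultra_proper _ _ FU).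
Local Existing Instance FF.

Implicit Types r s : I -> realalg.

Definition limited r : Prop := exists m, F [set i | L m i (r i)].

(** [phi] acts on single real algebraic numbers; here it is applied to a sequence index by index,
    through representatives of its values. The result respects the operations on limited
    sequences. *)
Definition reduce r : Fhat pP :=
  Fhat_of pP (fun i => repr (Fhat_val (phi (r i))) i).

Lemma level_le m n i : (m <= n)%N -> L m i `<=` L n i.
Proof.
by move=> /subnK <-; elim: (n - m)%N => //= j IH z /IH; exact: (level_mono Ls).
Qed.

Lemma limited2 r s : limited r -> limited s ->
  exists m, F [set i | L m i (r i) /\ L m i (s i)].
Proof.
move=> [m rm] [n sn]; exists (maxn m n); apply: filterS2 rm sn => i rm sn.
by split; [apply: level_le rm | apply: level_le sn]; rewrite ?leq_maxl ?leq_maxr.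
Qed.

Lemma limitedD r s : limited r -> limited s -> limited (fun i => r i + s i).
Proof.
move=> lr ls; have [m h] := limited2 lr ls; exists m.+1.
by apply: filterS h => i [rm sm]; exact: (levelD Ls).
Qed.

Lemma limitedM r s : limited r -> limited s -> limited (fun i => r i * s i).
Proof.
move=> lr ls; have [m h] := limited2 lr ls; exists m.+1.
by apply: filterS h => i [rm sm]; exact: (levelM Ls).
Qed.

Lemma limitedN r : limited r -> limited (fun i => - r i).
Proof. by move=> [m h]; exists m.+1; apply: filterS h => i; exact: (levelN Ls). Qed.

Lemma limitedV r : limited r -> limited (fun i => (r i)^-1).
Proof. by move=> [m h]; exists m.+1; apply: filterS h => i; exact: (levelV Ls). Qed.

Lemma limited_cst z : limited (fun=> z).
Proof. by exists 0%N; exact: (level_std Ls). Qed.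

Lemma reduceD r s : limited r -> limited s ->
  reduce (fun i => r i + s i) = reduce r + reduce s.
Proof.
move=> lr ls; have [m h] := limited2 lr ls.
apply: (etrans _ (esym (Fhat_addE pP _ _))).
apply/Fhat_ofP; apply: filterS2 h (level_hom Ls m) => i [rm sm] hom_i.
by have [] := hom_i _ _ rm sm.
Qed.

Lemma reduceM r s : limited r -> limited s ->
  reduce (fun i => r i * s i) = reduce r * reduce s.
Proof.
move=> lr ls; have [m h] := limited2 lr ls.
apply: (etrans _ (esym (Fhat_mulE pP _ _))).
apply/Fhat_ofP; apply: filterS2 h (level_hom Ls m) => i [rm sm] hom_i.
by have [] := hom_i _ _ rm sm.
Qed.

Lemma reduce_cst z : reduce (fun=> z) = phi z.
Proof. exact: Fhat_ofK. Qed.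

Lemma reduce_ext r s : F [set i | r i = s i] -> reduce r = reduce s.
Proof. by move=> rs; apply/Fhat_ofP; apply: filterS rs => i /= ->. Qed.

Lemma reduceN r : limited r -> reduce (fun i => - r i) = - reduce r.
Proof.
move=> lr; apply/eqP; rewrite eq_sym -subr_eq0 -opprD oppr_eq0 -reduceD //.
  rewrite (@reduce_ext _ (fun=> 0)) ?reduce_cst ?rmorph0 //.
  by apply: filterS filterT => i _ /=; rewrite addrN.
exact: limitedN.
Qed.

(** If r were nonzero almost everywhere, its product with its inverse would reduce to 1, although
    one factor reduces to 0. *)
Lemma reduce_eq0 r : limited r -> reduce r = 0 -> F [set i | r i = 0].
Proof.
move=> lr r0; have [//|nr] := @in_ultra_setVsetC _ _ [set i | r i = 0] FU.
have := reduceM lr (limitedV lr); rewrite r0 mul0r.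
rewrite (@reduce_ext _ (fun=> 1)) ?reduce_cst ?rmorph1 => [/eqP|].
  by rewrite oner_eq0.
by apply: filterS nr => i /= /eqP ri; rewrite divff.
Qed.

Lemma reduce_inj r s : limited r -> limited s -> reduce r = reduce s ->
  F [set i | r i = s i].
Proof.
move=> lr ls rs; have := reduce_eq0 (limitedD lr (limitedN ls)).
rewrite reduceD ?reduceN //; last exact: limitedN.
rewrite rs subrr => /(_ erefl); apply: filterS => i /= /eqP.
by rewrite subr_eq0 => /eqP.
Qed.

Lemma reduceV r : limited r -> reduce (fun i => (r i)^-1) = (reduce r)^-1.
Proof.
move=> lr; have [h|nr] := @in_ultra_setVsetC _ _ [set i | r i = 0] FU.
  rewrite (@reduce_ext r (fun=> 0)) // (@reduce_ext _ (fun=> 0)).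
    by rewrite reduce_cst rmorph0 invr0.
  by apply: filterS h => i /= ->; rewrite invr0.
have r1 : reduce r * reduce (fun i => (r i)^-1) = 1.
  rewrite -reduceM //; last exact: limitedV.
  rewrite (@reduce_ext _ (fun=> 1)) ?reduce_cst ?rmorph1 //.
  by apply: filterS nr => i /= /eqP ri; rewrite divff.
have r0 : reduce r != 0 by apply: contraTneq (oner_neq0 (Fhat pP)) => r0; rewrite -r1 r0 mul0r eqxx.
by apply: (mulfI r0); rewrite r1 divff.
Qed.

Definition reductions : set (Fhat pP) := [set reduce r | r in limited].

Lemma reductions1 : reductions 1.
Proof. by exists (fun=> 1); [exact: limited_cst | rewrite reduce_cst rmorph1]. Qed.

Lemma reductionsB x y : reductions x -> reductions y -> reductions (x - y).
Proof.
move=> [r lr <-] [s ls <-]; exists (fun i => r i + - s i).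
  by apply: limitedD => //; exact: limitedN.
by rewrite reduceD ?reduceN //; exact: limitedN.
Qed.

Lemma reductionsV x y : reductions x -> reductions y -> reductions (x / y).
Proof.
move=> [r lr <-] [s ls <-]; exists (fun i => r i * (s i)^-1).
  by apply: limitedM => //; exact: limitedV.
by rewrite reduceM ?reduceV //; exact: limitedV.
Qed.

Definition hyperalg_divring : divringClosed (Fhat pP) :=
  divring_of reductions1 reductionsB reductionsV.

Definition hyperalg := subfield hyperalg_divring.
HB.instance Definition _ := GRing.Field.on hyperalg.

Implicit Types x y : hyperalg.

Definition hyperalg_val : {rmorphism hyperalg -> Fhat pP} :=
  (val : {rmorphism subfield hyperalg_divring -> Fhat pP}).

Lemma hyperalg_valP x : reductions (hyperalg_val x).
Proof.
by apply/(mem_divring_of reductions1 reductionsB reductionsV); exact: valP.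
Qed.

(** A sequence reducing to x, unique almost everywhere by [rep_uniq]. Through it the field of
    reductions becomes a subfield of the ultrapower of the real algebraic numbers, from which it
    takes its order. *)
Definition rep x : I -> realalg := sval (cid2 (hyperalg_valP x)).

Lemma rep_limited x : limited (rep x).
Proof. by rewrite /rep; case: cid2. Qed.

Lemma reduce_rep x : reduce (rep x) = hyperalg_val x.
Proof. by rewrite /rep; case: cid2. Qed.

Lemma hyperalg_of r : limited r -> {x | hyperalg_val x = reduce r}.
Proof.
move=> lr; have rK : reduce r \in hyperalg_divring.
  by apply/mem_divring_of; exists r.
by exists (Sub (reduce r) rK : subfield hyperalg_divring).
Qed.

Lemma rep_uniq x r : limited r -> hyperalg_val x = reduce r ->
  F [set i | rep x i = r i].
Proof.
by move=> lr xr; apply: reduce_inj => //; [exact: rep_limited | rewrite reduce_rep].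
Qed.

Lemma repD x y : F [set i | rep (x + y) i = rep x i + rep y i].
Proof.
apply: rep_uniq; first by apply: limitedD; exact: rep_limited.
by rewrite reduceD ?reduce_rep ?rmorphD //; exact: rep_limited.
Qed.

Lemma repM x y : F [set i | rep (x * y) i = rep x i * rep y i].
Proof.
apply: rep_uniq; first by apply: limitedM; exact: rep_limited.
by rewrite reduceM ?reduce_rep ?rmorphM //; exact: rep_limited.
Qed.

Lemma repN x : F [set i | rep (- x) i = - rep x i].
Proof.
apply: rep_uniq; first by apply: limitedN; exact: rep_limited.
by rewrite reduceN ?reduce_rep ?rmorphN //; exact: rep_limited.
Qed.

Lemma rep0 : F [set i | rep 0 i = 0].
Proof. by apply: rep_uniq; [exact: limited_cst | rewrite reduce_cst !rmorph0]. Qed.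

Lemma rep_inj x y : F [set i | rep x i = rep y i] -> x = y.
Proof.
by move=> xy; apply: (fmorph_inj hyperalg_val); rewrite -!reduce_rep; exact: reduce_ext.
Qed.

Definition hyperalg_le x y : bool := `[< F [set i | rep x i <= rep y i] >].
Definition hyperalg_norm x : hyperalg := if hyperalg_le 0 x then x else - x.

Lemma hyperalg_le0P x : hyperalg_le 0 x <-> F [set i | 0 <= rep x i].
Proof.
by split=> [/asboolP|] h; last apply/asboolP; apply: filterS2 rep0 h => i /= ->.
Qed.

Lemma hyperalg_le0_add x y :
  hyperalg_le 0 x -> hyperalg_le 0 y -> hyperalg_le 0 (x + y).
Proof.
move=> /hyperalg_le0P x0 /hyperalg_le0P y0; apply/hyperalg_le0P.
by apply: filterS3 (repD x y) x0 y0 => i /= ->; exact: addr_ge0.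
Qed.

Lemma hyperalg_le0_mul x y :
  hyperalg_le 0 x -> hyperalg_le 0 y -> hyperalg_le 0 (x * y).
Proof.
move=> /hyperalg_le0P x0 /hyperalg_le0P y0; apply/hyperalg_le0P.
by apply: filterS3 (repM x y) x0 y0 => i /= ->; exact: mulr_ge0.
Qed.

Lemma hyperalg_le_anti x y : hyperalg_le x y -> hyperalg_le y x -> x = y.
Proof.
move=> /asboolP xy /asboolP yx; apply: rep_inj.
by apply: filterS2 xy yx => i /= xy yx; apply/eqP; rewrite eq_le xy yx.
Qed.

Lemma hyperalg_sub_ge0 x y : hyperalg_le 0 (y - x) = hyperalg_le x y.
Proof.
apply/idP/idP => [/hyperalg_le0P h|/asboolP h].
  apply/asboolP; apply: filterS3 (repD y (- x)) (repN x) h => i /= -> ->.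
  by rewrite subr_ge0.
apply/hyperalg_le0P; apply: filterS3 (repD y (- x)) (repN x) h => i /= -> ->.
by rewrite subr_ge0.
Qed.

Lemma hyperalg_le_total x y : hyperalg_le x y || hyperalg_le y x.
Proof.
apply/orP; have : F ([set i | rep x i <= rep y i] `|` [set i | rep y i <= rep x i]).
  by apply: filterS filterT => i _; apply/orP; exact: le_total.
by case/(ultra_or FU) => h; [left|right]; apply/asboolP.
Qed.

Lemma hyperalg_normN x : hyperalg_norm (- x) = hyperalg_norm x.
Proof.
have le0N y : hyperalg_le 0 (- y) = hyperalg_le y 0.
  by rewrite -[RHS]hyperalg_sub_ge0 sub0r.
rewrite /hyperalg_norm le0N opprK.
case: ifP => x0; case: ifP => x0' //; last by have := hyperalg_le_total 0 x; rewrite x0 x0'.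
by rewrite (hyperalg_le_anti x0 x0') oppr0.
Qed.

Lemma hyperalg_ge0_norm x : hyperalg_le 0 x -> hyperalg_norm x = x.
Proof. by rewrite /hyperalg_norm => ->. Qed.

HB.instance Definition _ := Num.IntegralDomain_isLeReal.Build hyperalg
  hyperalg_le0_add hyperalg_le0_mul (fun x a b => esym (hyperalg_le_anti a b))
  hyperalg_sub_ge0 (hyperalg_le_total 0) hyperalg_normN hyperalg_ge0_norm
  (fun _ _ => erefl).

Lemma hyperalg_leP x y : x <= y <-> F [set i | rep x i <= rep y i].
Proof. by split=> [/asboolP|h] //; apply/asboolP. Qed.

Lemma rep_horner (c : seq hyperalg) x :
  F [set i | (Poly [seq rep a i | a <- c]).[rep x i] = rep (Poly c).[x] i].
Proof.
elim: c => [|a c IH] /=.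
  by apply: filterS rep0 => i /= r0; rewrite !horner0 r0.
rewrite horner_cons; apply: filterS3 IH (repD ((Poly c).[x] * x) a)
  (repM (Poly c).[x] x) => i /= IHi ai mi.
by rewrite horner_cons IHi ai mi.
Qed.

(** The real algebraic numbers are real closed, so the i-th polynomial has a root between the i-th
    endpoints. These roots form a limited sequence, being roots of polynomials of standard size with
    coefficients in a common level. *)
Lemma hyperalg_ivt : Num.real_closed_axiom hyperalg.
Proof.
move=> q a b ab /andP[qa qb].
have [->|q0] := eqVneq q 0; first by exists a; rewrite ?lexx ?root0.
pose Q i := Poly [seq rep c i | c <- q].
have QE x : F [set i | (Q i).[rep x i] = rep q.[x] i].
  by have := rep_horner q x; rewrite polyseqK.
have [|x xP] := @ultra_choice I F FU realalg 0
  (fun i (x : realalg) => rep a i <= x <= rep b i /\ root (Q i) x).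
  move/hyperalg_leP: ab => ab; move/hyperalg_leP: qa => qa.
  move/hyperalg_le0P: qb => qb.
  apply: filterS3 (filterI ab rep0) (filterI qa (QE a)) (filterI qb (QE b)).
  move=> i /= [abi ri0] [qai Qa] [qbi Qb]; rewrite ri0 -Qa in qai.
  rewrite -Qb in qbi; have [|x ax xQ] := @poly_ivt _ (Q i) _ _ abi.
    by rewrite qai qbi.
  by exists x.
(* [level_root] asks for nonzero polynomials; the leading coefficient of q makes them nonzero almost
   everywhere. *)
have Qn0 : F [set i | Q i != 0].
  have [//|Qz] := @in_ultra_setVsetC _ _ [set i | Q i != 0] FU.
  have lc0 : F [set i | rep (lead_coef q) i = 0].
    apply: filterS Qz => i /= /negP; rewrite negbK => /eqP Q0.
    have := congr1 (fun P : {poly realalg} => P`_(size q).-1) Q0.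
    rewrite coef0 coef_Poly (nth_map 0) // prednK ?size_poly_gt0 //.
  exfalso; move: q0; rewrite -lead_coef_eq0 => /eqP; apply; apply: rep_inj.
  by apply: filterS2 lc0 rep0 => i /= -> ->.
have lx : limited x.
  have [m mP] : exists m, F [set i | forall c, c \in (q : seq hyperalg) -> L m i (rep c i)].
    elim: (q : seq hyperalg) => [|c l [m IH]].
      by exists 0%N; apply: filterS filterT.
    have [n cn] := rep_limited c; exists (maxn m n).
    apply: filterS2 IH cn => i /= IH cn d; rewrite inE => /predU1P[->|/IH].
      by apply: level_le cn; rewrite leq_maxr.
    by apply: level_le; rewrite leq_maxl.
  exists m.+1; apply: filterS3 (level_root Ls m (size q)) (filterI mP Qn0) xP.
  move=> i /= root_i [mi Qi0] [_ Qx]; apply: root_i Qx => //.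
    by rewrite (leq_trans (size_Poly _)) // size_map.
  move=> c cQ; have : c \in [seq rep d i | d <- q].
    have /(nthP 0)[k kQ <-] := cQ; rewrite coef_Poly; apply: mem_nth.
    by apply: leq_trans kQ (size_Poly _).
  by move=> /mapP[d dq ->]; exact: mi.
have [X Xx] := hyperalg_of lx; have Xrep := rep_uniq lx Xx.
exists X.
  apply/andP; split; apply/hyperalg_leP; apply: filterS2 Xrep xP => i /= ->.
    by move=> [/andP[]].
  by move=> [/andP[]].
rewrite rootE; apply/eqP; apply: rep_inj.
apply: filterS3 (filterI (QE X) rep0) Xrep xP => i /= [<- ->] -> [_] /eqP.
by [].
Qed.

HB.instance Definition _ := Num.RealField_isClosed.Build hyperalg hyperalg_ivt.

Lemma rep_rat (q : rat) : F [set i | rep (ratr q) i = ratr q].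
Proof.
apply: rep_uniq; first exact: limited_cst.
by rewrite reduce_cst !fmorph_rat.
Qed.

(** Rationals [q k] tending to t are chosen, and x is their term at the infinite index [v]. *)
Lemma hyperalg_near (R : realType) (t : R) : exists x : hyperalg, near_std x t.
Proof.
have qk k : {q : rat | `|t - ratr q| <= k.+1%:R^-1}.
  apply: cid; have [|q] := @rat_in_itvoo R t (t + k.+1%:R^-1).
    by rewrite ltrDl invr_gt0 ltr0n.
  rewrite in_itv /= => /andP[tq qt]; exists q.
  by rewrite distrC ger0_norm ?subr_ge0 ?(ltW tq) // lerBlDl ltW.
pose q k := sval (qk k); have qP k : `|t - ratr (q k)| <= k.+1%:R^-1 := svalP (qk k).
have [v vL vinf] := level_sat Ls (fun k => ratr (q k)).
have lx : limited (fun i => ratr (q (v i))) by exists 0%N.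
have [x xE] := hyperalg_of lx; have xrep := rep_uniq lx xE.
exists x => e e0.
(* From index k on the rationals are within e/2 of t, hence within e of each other, so that [q k]
   approximates both t and x. *)
pose k := Num.bound (2 / e).
have k1 : k.+1%:R^-1 <= e / 2.
  rewrite -[e / 2]invrK lef_pV2 ?posrE ?ltr0n ?invr_gt0 ?divr_gt0 //.
  rewrite invf_div ltW // (lt_trans (archi_boundP _)) ?divr_ge0 ?ltW //.
  by rewrite ltr_nat.
have kR (n : nat) : (k <= n)%N -> n.+1%:R^-1 <= ratr (e / 2) :> R.
  move=> kn; rewrite (@le_trans _ _ (ratr k.+1%:R^-1)) ?ler_rat //.
  by rewrite fmorphV rmorph_nat lef_pV2 ?posrE ?ltr0n // ler_nat.
exists (q k); split; last first.
  rewrite (le_trans (qP k)) // (le_trans (kR k _)) // ler_rat.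
  by rewrite ler_pdivrMr // ler_peMr // ?ltW // ler1n.
rewrite ler_norml lerBlDr lerBrDr.
suff h : F [set i | `|rep x i - ratr (q k)| <= ratr e :> realalg].
  apply/andP; split; apply/hyperalg_leP.
    rewrite -rmorphN -rmorphD; apply: filterS2 h (rep_rat (- e + q k)) => i /= + ->.
    by rewrite ler_norml rmorphD rmorphN /= => /andP[+ _]; rewrite lerBrDr.
  rewrite -rmorphD; apply: filterS2 h (rep_rat (e + q k)) => i /= + ->.
  by rewrite ler_norml rmorphD /= => /andP[_]; rewrite lerBlDr.
apply: filterS2 xrep (vinf k) => i /= -> kv.
rewrite -rmorphB -ratr_norm ler_rat -(ler_rat R) ratr_norm rmorphB /=.
have -> : ratr (q (v i)) - ratr (q k) = (t - ratr (q k)) - (t - ratr (q (v i))) :> R by ring.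
have -> : e = e / 2 + e / 2 by field.
rewrite rmorphD (le_trans (ler_normB _ _)) // lerD //.
  by rewrite (le_trans (qP k)) ?kR.
by rewrite (le_trans (qP _)) ?kR.
Qed.

(** The witness is the inverse of v + 1 for an infinite v supplied by [level_sat]. *)
Lemma hyperalg_infinitesimal (R : realType) :
  exists2 x : hyperalg, x != 0 & near_std x (0 : R).
Proof.
have [v vL vinf] := level_sat Ls (fun k => k.+1%:R^-1).
have lx : limited (fun i => (v i).+1%:R^-1) by exists 0%N.
have [x xE] := hyperalg_of lx; have xrep := rep_uniq lx xE.
exists x.
  apply/eqP => x0; rewrite x0 in xrep.
  apply: (@filter_not_empty _ _ (@ultra_proper _ _ FU)).
  apply: filterS2 xrep rep0 => i /= -> /eqP.
  by rewrite invr_eq0 pnatr_eq0.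
move=> e e0; exists 0; rewrite !rmorph0 !subr0 normr0 ler0q (ltW e0); split=> //.
pose k := Num.bound e^-1.
have xe : F [set i | 0 <= rep x i <= ratr e].
  apply: filterS2 xrep (vinf k) => i /= -> kv.
  rewrite invr_ge0 ler0n /= -[_^-1](_ : ratr ((v i).+1%:R^-1) = _); last first.
    by rewrite fmorphV rmorph_nat.
  rewrite ler_rat -[e]invrK lef_pV2 ?posrE ?ltr0n ?invr_gt0 //.
  rewrite ltW // (lt_le_trans (archi_boundP _)) ?invr_ge0 ?ltW //.
  by rewrite ltr_nat ltnS.
rewrite ger0_norm.
  by apply/hyperalg_leP; apply: filterS2 xe (rep_rat e) => i /= /andP[_ +] ->.
by apply/hyperalg_le0P; apply: filterS xe => i /= /andP[].
Qed.

End HyperAlgebraic.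

(** * Carriers as increasing unions of internal levels *)

Section Carriers.
Variables (I : Type) (F : set_system I) (FU : UltraFilter F).
Variables (p : starN FU) (pP : star_prime p).
Variable phi : {rmorphism realalg -> Fhat pP}.
Variable L : nat -> I -> set realalg.
Hypothesis Ls : level_system phi L.

Let FF : Filter F := @filter_filter _ _ (@ultra_proper _ _ FU).
Local Existing Instance FF.

Variables (iota : Fhat pP) (K : divringClosed (Fhat pP)).
Hypothesis K_reductions : forall a, a \in K <->
  exists x y, [/\ reductions phi L x, reductions phi L y & a = x + iota * y].

Let ph i z := repr (Fhat_val (phi z)) i.

(** With a square root of -1 for [iota] these levels exhaust the algebraically closed field, with 0
    for [iota] the real closed one. *)
Definition carrier_level (m : nat) (i : I) : set nat :=
  [set n | exists z w, [/\ L m i z, L m i w &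
    n = (ph i z + repr (Fhat_val iota) i * ph i w) %% repr p i]%N].

Lemma carrier_limit : carrier K = @limit_set I F FU carrier_level.
Proof.
have valE r s : Fhat_val (reduce phi r + iota * reduce phi s) =
    starN_of FU (fun i => (ph i (r i) + repr (Fhat_val iota) i * ph i (s i)) %% repr p i)%N.
  rewrite -Fhat_val_of -[in LHS](Fhat_ofK iota); congr Fhat_val.
  apply: (etrans _ (Fhat_addE pP _ _)); congr (_ + _).
  exact: (Fhat_mulE pP).
apply/seteqP; split=> [_ [a /= /K_reductions[_ [_ [[r lr <-] [s ls <-] ->]]] <-]|x].
  have [m mP] := limited2 Ls lr ls; exists m; rewrite valE; apply/istar_of.
  by apply: filterS mP => i [rm sm]; exists (r i), (s i).
move=> [m /(@ultra_choice I F FU realalg 0)[r /(@ultra_choice I F FU realalg 0)[s h]]].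
exists (reduce phi r + iota * reduce phi s).
  apply/K_reductions; exists (reduce phi r), (reduce phi s); split => //.
    by exists r => //; exists m; apply: filterS h => i [].
  by exists s => //; exists m; apply: filterS h => i [].
rewrite valE -[RHS]starN_ofK; apply/starN_ofP; apply: filterS h => i [_ _ E].
exact: esym.
Qed.

Lemma carrier_level_mono m i : carrier_level m i `<=` carrier_level m.+1 i.
Proof.
move=> _ [z [w [zm wm ->]]]; exists z, w; split => //; exact: (level_mono Ls).
Qed.

Lemma carrier_sigma : sigma_set (carrier K).
Proof. by rewrite carrier_limit; exact: limit_set_sigma. Qed.

Lemma carrier_almost_internal : almost_internal (carrier K).
Proof.
by rewrite carrier_limit; apply: limit_set_almost_internal; exact: carrier_level_mono.
Qed.

End Carriers.

(** * Adjoining a square root of -1 *)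

Section ComplexExtension.
Variables (T : rcfType) (E : fieldType) (v : {rmorphism T -> E}) (iota : E).
Hypothesis iota2 : iota ^+ 2 = -1.

Definition complex_ext (z : T[i]) : E := v (complex.Re z) + iota * v (complex.Im z).

Lemma complex_ext1 : complex_ext 1 = 1.
Proof. by rewrite /complex_ext /= rmorph1 rmorph0 mulr0 addr0. Qed.

Lemma complex_extB : {morph complex_ext : x y / x - y}.
Proof. by move=> [a b] [c d]; rewrite /complex_ext /= !rmorphB; ring. Qed.

Lemma complex_extM : {morph complex_ext : x y / x * y}.
Proof.
move=> [a b] [c d]; rewrite /complex_ext /= rmorphB rmorphD !rmorphM.
rewrite mulrDl !mulrDr [iota * _ * (iota * _)]mulrACA -expr2 iota2 mulN1r.
by rewrite !mulrA [v a * iota]mulrC -!addrA; congr (_ + _); ring.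
Qed.

Definition complex_rmorph : {rmorphism T[i] -> E} :=
  rmorph_of complex_ext1 complex_extB complex_extM.

Lemma complex_range1 : range complex_rmorph 1.
Proof. by exists 1 => //; rewrite rmorph1. Qed.

Lemma complex_rangeB x y : range complex_rmorph x -> range complex_rmorph y ->
  range complex_rmorph (x - y).
Proof. by move=> [a _ <-] [b _ <-]; exists (a - b) => //; rewrite rmorphB. Qed.

Lemma complex_rangeV x y : range complex_rmorph x -> range complex_rmorph y ->
  range complex_rmorph (x / y).
Proof. by move=> [a _ <-] [b _ <-]; exists (a / b) => //; rewrite fmorph_div. Qed.

Definition complex_divring : divringClosed E :=
  divring_of complex_range1 complex_rangeB complex_rangeV.

Lemma mem_complex_divring a : a \in complex_divring <-> exists x y, a = v x + iota * v y.
Proof.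
split=> [/mem_divring_of[[x y] _ <-]|[x [y ->]]]; first by exists x, y.
by apply/mem_divring_of; exists (x +i* y)%C.
Qed.

(** The coefficients lift to [T[i]], which is algebraically closed since T is real closed; a root
    found there is mapped back. *)
Lemma complex_divring_closed : algebraically_closed (subfield complex_divring).
Proof.
move=> n P n0; have cP k : {c | complex_rmorph c = val (P k)}.
  have /mem_divring_of h := valP (P k).
  by apply: cid; have [c _ cE] := h; exists c.
have [z zE] := @solve_monicpoly T[i] n (fun k => sval (cP k)) n0.
have zK : complex_rmorph z \in complex_divring by apply/mem_divring_of; exists z.
exists (MkSubfield zK); apply: val_inj.
transitivity (complex_rmorph z ^+ n); first by rewrite rmorphXn.
rewrite -[LHS]rmorphXn zE !rmorph_sum; apply: eq_bigr => k _.
by rewrite [LHS]rmorphM [in LHS]rmorphXn (svalP (cP k)) [RHS]rmorphM rmorphXn.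
Qed.

(** Provides the morphism that [many_embeddings] takes when the extended field is the target. *)
Lemma complex_divring_val : exists j : {rmorphism T -> subfield complex_divring}, True.
Proof.
have vK x : v x \in complex_divring.
  by apply/mem_complex_divring; exists x, 0; rewrite rmorph0 mulr0 addr0.
pose j x : subfield complex_divring := MkSubfield (vK x).
have j1 : j 1 = 1 by apply: val_inj; rewrite /= rmorph1.
have jB : {morph j : x y / x - y} by move=> x y; apply: val_inj; rewrite /= rmorphB.
have jM : {morph j : x y / x * y} by move=> x y; apply: val_inj; rewrite /= rmorphM.
by exists (rmorph_of j1 jB jM).
Qed.

End ComplexExtension.

(** One embedding of R carries the injective family [liou] into K; it exists because the set of
    embeddings cannot be empty. *)
Lemma continuum_carrier (I : Type) (F : set_system I) (FU : UltraFilter F)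
    (p : starN FU) (pP : star_prime p) (K : divringClosed (Fhat pP)) (R : realType) :
  [set: set (set nat)] #<= embeddings R (subfield K) ->
  [set: set nat] #<= carrier K.
Proof.
move=> card_emb; have [_ [f _ _]] : exists f, embeddings R (subfield K) f.
  apply: contrapT => nf; suff E0 : embeddings R (subfield K) = set0.
    by move: card_emb; rewrite E0 card_le0 => /eqP/seteqP[/(_ set0 Logic.I)].
  by apply/seteqP; split => // f Ef; apply: nf; exists f.
apply: (@inj_card_leT _ _ _ (fun x => Fhat_val (val (f (liou R x))))).
  by move=> x; exists (val (f (liou R x))) => //; exact: valP.
by move=> x y /Fhat_val_inj /val_inj /fmorph_inj /liou_inj.
Qed.

(** * Cofinality of sigma-subfields and failure of saturation *)

Lemma finite_max (s : set nat) (le : nat -> nat -> Prop) (N : nat) :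
  (exists n, s n) -> (forall n, s n -> (n < N)%N) ->
  (forall a b, s a -> s b -> le a b \/ le b a) ->
  (forall a b c, s a -> s b -> s c -> le a b -> le b c -> le a c) ->
  exists m, s m /\ forall n, s n -> le n m.
Proof.
move=> [n0 sn0] sN tot tr.
suff [m sm mP] : exists2 m, s m & forall n, s n -> (n < N)%N -> le n m.
  by exists m; split => // n sn; apply: mP => //; exact: sN.
have {sN} : exists2 n, s n & (n < N)%N by exists n0 => //; exact: sN.
(* Induction on the bound: a maximum of the part below N is compared with N. *)
elim: N => [|N IH] [n sn]; first by [].
have leNN : s N -> le N N by move=> sN; case: (tot _ _ sN sN).
have [[k sk kN]|nk] := pselect (exists2 k, s k & (k < N)%N); last first.
  rewrite ltnS leq_eqVlt => /predU1P[nN|nN]; last by case: nk; exists n.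
  rewrite {n}nN in sn; exists N => // k sk; rewrite ltnS leq_eqVlt.
  by move=> /predU1P[->|kN]; [exact: leNN | case: nk; exists k].
move=> _; have [|m sm mP] := IH; first by exists k.
have [sN|nsN] := pselect (s N); last first.
  exists m => // j sj; rewrite ltnS leq_eqVlt => /predU1P[jN|]; last exact: mP.
  by rewrite jN in sj.
have [mN|Nm] := tot m N sm sN.
  exists N => // j sj; rewrite ltnS leq_eqVlt => /predU1P[->|jN]; first exact: leNN.
  by apply: (tr _ m) => //; exact: mP.
by exists m => // j sj; rewrite ltnS leq_eqVlt => /predU1P[->|jN] //; exact: mP.
Qed.

Section NotSaturated.
Variables (I : Type) (F : set_system I) (FU : UltraFilter F).
Variables (p : starN FU) (pP : star_prime p).
Hypothesis no_sqrtN1 : ~ exists i : Fhat pP, i ^+ 2 = -1.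
Variables (K : divringClosed (Fhat pP)) (R0 : rcfType).
Variable f : {rmorphism R0 -> subfield K}.
Hypothesis f_bij : bijective f.

Let FF : Filter F := @filter_filter _ _ (@ultra_proper _ _ FU).
Local Existing Instance FF.

Implicit Types (a b c : R0).

Let v a : Fhat pP := val (f a).
Let rv a : I -> nat := repr (Fhat_val (v a)).

Lemma le_square a b : a <= b -> exists c, b = a + c ^+ 2.
Proof.
by move=> ab; exists (Num.sqrt (b - a)); rewrite sqr_sqrtr ?subr_ge0 // addrC subrK.
Qed.

(* As -1 is not a square, the order of K is induced by the internal relation
   "y - x is a square in Fhat". *)
Lemma le_square_Fhat a b : a <= b <-> exists w, v b = v a + w ^+ 2.
Proof.
split=> [/le_square[c ->]|[w bE]]; first by exists (v c); rewrite /v !rmorphD !rmorphXn.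
case/orP: (le_total a b) => [//|/le_square[c aE]].
have [c0|c0] := eqVneq c 0; first by rewrite aE c0 expr0n addr0.
case: no_sqrtN1; exists (w / v c); rewrite expr_div_n.
have vc0 : v c != 0 by rewrite /v !fmorph_eq0.
have va : v a = v b + v c ^+ 2 by rewrite aE /v !rmorphD !rmorphXn.
have : w ^+ 2 = - v c ^+ 2.
  apply/eqP; rewrite -subr_eq0 opprK addrC; apply/eqP.
  by apply: (addrI (v b)); rewrite addr0 addrA -va -bE.
by move=> ->; rewrite mulNr divff // expf_eq0.
Qed.

(** The relation of [le_square_Fhat] at a single index. It need not be an order on all residues, but
    it inherits totality and transitivity on the components of internal subsets of K. *)
Definition mod_le i (m n : nat) : Prop :=
  exists k, n = (m + k * k)%N %[mod repr p i].

Lemma le_mod a b : a <= b <-> F [set i | mod_le i (rv a i) (rv b i)].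
Proof.
have vE c : v c = Fhat_of pP (rv c) by rewrite Fhat_ofK.
split=> [/le_square_Fhat[w]|].
  rewrite !vE -[w]Fhat_ofK expr2 => E.
  have /Fhat_ofP := etrans E (etrans (congr1 _ (Fhat_mulE pP _ _)) (Fhat_addE pP _ _)).
  by apply: filterS => i E'; exists (repr (Fhat_val w) i).
move=> /(@ultra_choice I F FU nat 0%N)[k kP]; apply/le_square_Fhat.
exists (Fhat_of pP k); rewrite !vE expr2.
apply: (etrans _ (esym (etrans (congr1 _ (Fhat_mulE pP _ _)) (Fhat_addE pP _ _)))).
exact/Fhat_ofP.
Qed.

(** Totality and transitivity of the order pass to the components [s i] for F-most i. These are
    finite, being bounded by [repr p i], so [finite_max] gives each nonempty one a greatest element,
    and the sequence of these represents the bound. *)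
Lemma internal_bounded (A : set (starN FU)) : internal_set A -> A `<=` carrier K ->
  exists a, forall b, A (Fhat_val (v b)) -> b <= a.
Proof.
move=> /internal_setP[s ->] sK.
have [[x0 x0s]|ns] := pselect (exists x, istar s x); last first.
  by exists 0 => b bs; case: ns; exists (Fhat_val (v b)).
(* A sequence with terms in the components represents an element of K; this turns counterexamples
   chosen index by index into elements of [R0]. *)
have elt (d : I -> nat) : F [set i | s i (d i)] -> exists a, F [set i | rv a i = d i].
  move=> sd; have /sK[x xK xE] : istar s (starN_of FU d) by exact/istar_of.
  have [g fK gK] := f_bij.
  exists (g (MkSubfield xK)); rewrite /rv /v gK /= xE.
  exact: repr_starN_of.
have s_lt : F [set i | forall n, s i n -> (n < repr p i)%N].
  have [//|nF] := @in_ultra_setVsetC _ _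
    [set i | forall n, s i n -> (n < repr p i)%N] FU.
  have [|d dP] := @ultra_choice I F FU nat 0%N
      (fun i n => s i n /\ ~ (n < repr p i)%N).
    by apply: filterS nF => i /= /existsNP[n /not_implyP nP]; exists n.
  have [|a aE] := elt d; first by apply: filterS dP => i [].
  have /asboolP a_lt : starN_rel ltn (Fhat_val (v a)) p by case: (v a).
  exfalso; apply: (@filter_not_empty _ _ (@ultra_proper _ _ FU)).
  by apply: filterS3 dP aE a_lt => i /= [_ +] di; rewrite -di.
have s_tot : F [set i | forall m n, s i m -> s i n -> mod_le i m n \/ mod_le i n m].
  have [//|nF] := @in_ultra_setVsetC _ _
    [set i | forall m n, s i m -> s i n -> mod_le i m n \/ mod_le i n m] FU.
  have [|d dP] := @ultra_choice I F FU (nat * nat)%type (0, 0)%N (fun i d =>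
      [/\ s i d.1, s i d.2 & ~ (mod_le i d.1 d.2 \/ mod_le i d.2 d.1)]).
    apply: filterS nF => i /= /existsNP[m /existsNP[n]].
    by move=> /not_implyP[sm /not_implyP[sn h]]; exists (m, n).
  have [|a aE] := elt (fun i => (d i).1); first by apply: filterS dP => i [].
  have [|b bE] := elt (fun i => (d i).2); first by apply: filterS dP => i [].
  exfalso; apply: (@filter_not_empty _ _ (@ultra_proper _ _ FU)).
  have [ab|ab] := leP a b.
    move/le_mod in ab; apply: filterS3 (filterI aE bE) ab dP => i /= [-> ->] h [_ _].
    by apply; left.
  move/ltW/le_mod in ab; apply: filterS3 (filterI aE bE) ab dP => i /= [-> ->] h [_ _].
  by apply; right.
have s_tr : F [set i | forall l m n, s i l -> s i m -> s i n ->
    mod_le i l m -> mod_le i m n -> mod_le i l n].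
  have [//|nF] := @in_ultra_setVsetC _ _ [set i | forall l m n, s i l -> s i m ->
    s i n -> mod_le i l m -> mod_le i m n -> mod_le i l n] FU.
  have [|d dP] := @ultra_choice I F FU (nat * nat * nat)%type (0, 0, 0)%N (fun i d =>
      [/\ s i d.1.1, s i d.1.2 & s i d.2] /\ 
      [/\ mod_le i d.1.1 d.1.2, mod_le i d.1.2 d.2 & ~ mod_le i d.1.1 d.2]).
    apply: filterS nF => i /= /existsNP[l /existsNP[m /existsNP[n]]].
    move=> /not_implyP[sl /not_implyP[sm /not_implyP[sn]]].
    by move=> /not_implyP[lm /not_implyP[mn h]]; exists (l, m, n).
  have [|a aE] := elt (fun i => (d i).1.1); first by apply: filterS dP => i [[]].
  have [|b bE] := elt (fun i => (d i).1.2); first by apply: filterS dP => i [[]].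
  have [|c cE] := elt (fun i => (d i).2); first by apply: filterS dP => i [[]].
  have ab : a <= b.
    by apply/le_mod; apply: filterS3 aE bE dP => i /= -> -> [_ []].
  have bc : b <= c.
    by apply/le_mod; apply: filterS3 bE cE dP => i /= -> -> [_ []].
  have /le_mod ac := le_trans ab bc.
  exfalso; apply: (@filter_not_empty _ _ (@ultra_proper _ _ FU)).
  by apply: filterS3 (filterI aE cE) ac dP => i /= [-> ->] h [_ [_ _]].
have [|d dP] := @ultra_choice I F FU nat 0%N
    (fun i m => s i m /\ forall n, s i n -> mod_le i n m).
  apply: filterS3 (filterI x0s s_lt) s_tot s_tr => i /= [s0 slt] tot tr.
  by apply: (finite_max _ slt tot tr); exists (repr x0 i).
have [|a aE] := elt d; first by apply: filterS dP => i [].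
exists a => b bs; apply/le_mod; apply: filterS3 dP aE bs => i /= [_ h] -> sb.
exact: h.
Qed.

(** Let [a n] bound the n-th internal piece of K. The conditions that x is at least [a n] are
    finitely satisfiable, but a common solution x would bound all of K, which contains x + 1. *)
Lemma sigma_not_saturated : sigma_set (carrier K) -> ~ aleph1_saturated (subfield K).
Proof.
move=> [A [Aint KA]] sat; have [g fK gK] := f_bij.
have Abd n : {a | forall b, A n (Fhat_val (v b)) -> b <= a}.
  by apply: cid; apply: internal_bounded => // x Ax; rewrite KA; exists n.
pose a n := sval (Abd n); have aP n := svalP (Abd n).
(* The order is expressed by saying that the difference is a square; variable 0 is that of the type,
   variable 1 is the root. *)
pose above (c : subfield K) : GRing.formula (subfield K) :=
  GRing.Exists 1 (GRing.Equal (GRing.Add (GRing.Var _ 0) (GRing.Opp (GRing.Const c)))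
                              (GRing.Mul (GRing.Var _ 1) (GRing.Var _ 1))).
have aboveP c d : GRing.holds [:: f d] (above (f c)) <-> c <= d.
  split=> /=.
    move=> [y]; rewrite -(gK y) -rmorphB -rmorphM => /fmorph_inj E.
    by rewrite -subr_ge0 E -expr2 sqr_ge0.
  move=> /le_square[e ->]; exists (f e).
  by rewrite -rmorphB -rmorphM addrAC subrr add0r expr2.
have [||Psi finPsi PsiP|x xP] := sat (range (f \o a)) (range (above \o f \o a)).
- exact: card_image_le.
- by move=> _ [n _ <-] /=; split; split => //; exists n.
- have [N NP] : exists N, forall h, Psi h -> exists2 n, (n < N)%N & h = above (f (a n)).
    pose idx h := xget 0%N [set n | h = above (f (a n))].
    have /finite_seqP[l lE] := finite_image idx finPsi.
    exists (\max_(n <- l) n).+1 => h Ph; exists (idx h).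
      rewrite ltnS; apply: (leq_bigmax_seq (F := id)) => //.
      have : (idx @` Psi) (idx h) by exists h.
      by rewrite lE.
    rewrite /idx; case: xgetP => [n _ -> //|].
    move=> noidx; have [n _ nE] := PsiP _ Ph.
    by case: (noidx n); rewrite /= -nE.
  (* The sum of the absolute values dominates each of the finitely many bounds that occur. *)
  exists (f (\sum_(k < N) `|a k|)) => h /NP[n nN ->]; apply/aboveP.
  rewrite (bigD1 (Ordinal nN)) //= (le_trans (ler_norm _)) // lerDl.
  by apply: sumr_ge0 => k _; exact: normr_ge0.
- have xa n : a n <= g x.
    by apply/aboveP; rewrite gK; apply: xP; exists n.
  have : carrier K (Fhat_val (v (g x + 1))).
    by exists (v (g x + 1)) => //; exact: valP.
  rewrite KA => -[n _ /aP]; rewrite -/(a n) => /le_trans/(_ (xa n)).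
  by rewrite gerDl ler10.
Qed.

End NotSaturated.

(** * The two cases, according to whether -1 is a square *)

Theorem theorem0p8 (I : Type) (F : set_system I) (FU : UltraFilter F)
    (F_incomplete : countably_incomplete F)
    (p : starN FU) (p_prime : star_prime p) (p_nonstandard : ~ standard p)
    (realalg_embeds : inhabited {rmorphism realalg -> Fhat p_prime})
    (R : realType) :
  ((exists i : Fhat p_prime, i ^+ 2 = -1) ->
   exists K : divringClosed (Fhat p_prime),
     [/\ almost_internal (carrier K), sigma_set (carrier K),
         algebraically_closed (subfield K),
         [set: set nat] #<= carrier K &
         [set: set (set nat)] #<= embeddings R (subfield K)])
  /\
  (~ (exists i : Fhat p_prime, i ^+ 2 = -1) ->
   (exists K : divringClosed (Fhat p_prime),
      [/\ almost_internal (carrier K), sigma_set (carrier K),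
          real_closed (subfield K) &
          [set: set (set nat)] #<= embeddings R (subfield K)])
   /\
   (forall K : divringClosed (Fhat p_prime),
      sigma_set (carrier K) -> real_closed (subfield K) ->
      ~ aleph1_saturated (subfield K))).
Proof.
have [phi] := realalg_embeds; have [L Ls] := level_system_ex F_incomplete phi.
(* Both target fields receive a morphism from [hyperalg], so that one count of embeddings serves for
   both. *)
have many (E : fieldType) (j : {rmorphism hyperalg Ls -> E}) :
    [set: set (set nat)] #<= embeddings R E.
  have [eps eps0 epsP] := hyperalg_infinitesimal Ls R.
  exact: (many_embeddings j (hyperalg_near Ls (R := R)) eps0 epsP).
split=> [[iota iota2]|no_sqrtN1]; last split.
- pose K := complex_divring (hyperalg_val Ls) iota2.
  have KE a : a \in K <-> exists x y,
      [/\ reductions phi L x, reductions phi L y & a = x + iota * y].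
    split=> [/mem_complex_divring[x [y ->]]|[x [y [xr yr ->]]]].
      exists (hyperalg_val Ls x), (hyperalg_val Ls y).
      by split => //; exact: hyperalg_valP.
    apply/mem_complex_divring; have [r lr <-] := xr; have [s ls <-] := yr.
    have [x' <-] := hyperalg_of Ls lr; have [y' <-] := hyperalg_of Ls ls.
    by exists x', y'.
  have [j _] := complex_divring_val (hyperalg_val Ls) iota2.
  exists K; split.
  + exact: (carrier_almost_internal Ls KE).
  + exact: (carrier_sigma Ls KE).
  + exact: complex_divring_closed.
  + exact: (continuum_carrier (many _ j)).
  + exact: many j.
- pose K := hyperalg_divring Ls.
  (* The value 0 for [iota] brings the field of reductions into the form required by the carrier
     lemmas. *)
  have KE a : a \in K <-> exists x y,
      [/\ reductions phi L x, reductions phi L y & a = x + 0 * y].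
    split=> [/mem_divring_of ar|[x [y [xr _ ->]]]]; last first.
      by rewrite mul0r addr0; apply/mem_divring_of.
    by exists a, 1; split => //; [exact: (reductions1 Ls) | rewrite mul0r addr0].
  pose j : {rmorphism hyperalg Ls -> subfield K} := idfun.
  exists K; split.
  + exact: (carrier_almost_internal Ls KE).
  + exact: (carrier_sigma Ls KE).
  + by exists (hyperalg Ls : rcfType), j; exists idfun.
  + exact: many j.
- move=> K sigK [R0 [f f_bij]].
  exact: (sigma_not_saturated no_sqrtN1 f_bij sigK).
Qed.
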